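(* Let $F$ be a global field of characteristic not $2$ or $3$, and let $k\in F^*$. There is a bijection between the ${\rm SL}_2(F)$-orbits on the set of locally soluble forms in $V(F)$ of discriminant $4k$ and the elements of ${\rm Sel}_{\hat\phi}(E_{-27k})$ for the isogeny $\hat\phi\colon E_{-27k}\to E_k$. Under this bijection, the identity element of ${\rm Sel}_{\hat\phi}(E_{-27k})$ corresponds to the unique ${\rm SL}_2(F)$-orbit of reducible binary cubic forms of discriminant $4k$, namely the orbit of $f(x,y)=kx^3+3xy^2$. Moreover, the stabilizer in ${\rm SL}_2(F)$ of any locally soluble $f\in V(F)$ of discriminant $4k$ is isomorphic to $E_{-27k}[\hat\phi](F)$.
   Context: $E_k\colon y^2=x^3+k$; $\hat\phi\colon E_{-27k}\to E_k$ is the $3$-isogeny $(x,y)\mapsto\left(\frac{x^3-108k}{9x^2},\frac{y(x^3+216k)}{27x^3}\right)$. ${\rm Sel}_{\hat\phi}(E_{-27k})\subset H^1(G_F,E_{-27k}[\hat\phi])$ consists of classes whose restriction at every place $v$ of $F$ lies in the image of the connecting map $E_k(F_v)\to H^1(G_{F_v},E_{-27k}[\hat\phi])$. $V(F)$ is the space of binary cubic forms $f=[a,3b,3c,d]=au^3+3bu^2v+3cuv^2+dv^3$, $a,b,c,d\in F$, with ${\rm SL}_2(F)$ acting by linear change of variables; ${\rm disc}(f)=a^2d^2-6abcd+4ac^3+4b^3d-3b^2c^2$. A form $f\in V(F)$ is locally soluble if for every place $v$ of $F$ the equation $z^3=f(u,v)$ has a nonzero solution $(u,v,z)$ over $F_v$.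 *)

(* Defs.v *)
From HB Require Import structures.
From mathcomp Require Import all_boot all_order all_algebra all_field.
From mathcomp Require Import ring.
From mathcomp Require Import boolp classical_sets functions reals exp.

Set Implicit Arguments.
Unset Strict Implicit.
Unset Printing Implicit Defensive.

Import Order.TTheory GRing.Theory Num.Theory.
Local Open Scope classical_set_scope.
Local Open Scope ring_scope.

(** * Global fields, places and completions *)

Definition global_field (F : fieldType) : Prop :=
  (exists (L : fieldExtType rat) (i : {rmorphism L -> F}), bijective i) \/
  (exists (K : finFieldType) (L : fieldExtType {fraction {poly K}})
     (i : {rmorphism L -> F}), bijective i).

Section AbsoluteValues.
Variables (R : realType) (K : fieldType).

Record absolute_value (a : K -> R) : Prop := AbsoluteValue {
  absv_ge0 : forall x, 0 <= a x;
  absv_eq0 : forall x, a x = 0 <-> x = 0;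
  absvM : forall x y, a (x * y) = a x * a y;
  absvD : forall x y, a (x + y) <= a x + a y }.

Definition absv_equiv (a b : K -> R) : Prop :=
  exists2 s : R, 0 < s & forall x, b x = a x `^ s.

(* A place, archimedean or not, is an equivalence class of nontrivial
   absolute values. *)
Record place := Place {
  place_set : set (K -> R);
  placeP : exists a, [/\ absolute_value a, (exists2 x, x != 0 & a x != 1) &
             place_set = [set b | absolute_value b /\ absv_equiv a b]] }.

Definition absv_complete (a : K -> R) : Prop :=
  forall u : nat -> K,
    (forall e, 0 < e -> exists N, forall m n,
       (N <= m)%N -> (N <= n)%N -> a (u m - u n) < e) ->
    exists l, forall e, 0 < e -> exists N, forall n, (N <= n)%N -> a (u n - l) < e.

End AbsoluteValues.

Record completion (R : realType) (F : fieldType) (v : place R F) := Completion {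
  cp_field :> fieldType;
  cp_inj : {rmorphism F -> cp_field};
  cp_abs : cp_field -> R;
  cp_absP : absolute_value cp_abs;
  cp_place : place_set v (cp_abs \o cp_inj);
  cp_complete : absv_complete cp_abs;
  cp_dense : forall x e, 0 < e -> exists y, cp_abs (x - cp_inj y) < e }.

(** * Absolute Galois groups *)

(* [separable_poly p] is coprimality of [p] and its derivative; it excludes 0. *)
Record sep_closure (K : fieldType) := SepClosure {
  sc_field :> fieldType;
  sc_inj : {rmorphism K -> sc_field};
  sc_separable : forall x : sc_field,
    exists2 p : {poly K}, separable_poly p & root (map_poly sc_inj p) x;
  sc_closed : forall p : {poly sc_field},
    separable_poly p -> size p != 1%N -> exists x, root p x }.

Record gal (K : fieldType) (S : sep_closure K) := Gal {
  gal_fun :> {rmorphism S -> S};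
  gal_bij : bijective gal_fun;
  gal_fix : forall x, gal_fun (sc_inj S x) = sc_inj S x }.

Section GalMul.
Variables (K : fieldType) (S : sep_closure K) (s t : gal S).

Let mul_fun : {rmorphism S -> S} := gal_fun s \o gal_fun t.

Fact gal_mul_bij : bijective mul_fun.
Proof. exact: bij_comp (gal_bij s) (gal_bij t). Qed.

Fact gal_mul_fix x : mul_fun (sc_inj S x) = sc_inj S x.
Proof. by rewrite /= !gal_fix. Qed.

Definition gal_mul : gal S := Gal gal_mul_bij gal_mul_fix.

End GalMul.

(* The embedding of F^sep into the separable closure of F_v fixes a
   decomposition group at v. *)
Record localization (R : realType) (F : fieldType) (S : sep_closure F)
    (v : place R F) := Localization {
  loc_field :> completion v;
  loc_sep : sep_closure loc_field;
  loc_emb : {rmorphism S -> loc_sep};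
  loc_embE : forall x,
    loc_emb (sc_inj S x) = sc_inj loc_sep (cp_inj loc_field x) }.

Section GalRes.
Variables (R : realType) (F : fieldType) (S : sep_closure F) (v : place R F).
Variable (L : localization S v).
Local Notation emb := (loc_emb L).
Local Notation j := (@loc_embE _ _ _ _ L).

Lemma loc_emb_root (q : {poly S}) (y : loc_sep L) :
  separable_poly q -> root (map_poly emb q) y -> exists x, emb x = y.
Proof.
have [n] := ubnP (size q); elim: n q => // n IHn q le_q_n sep_q qy.
have [/size_poly1P[c c0 qE]|q1] := boolP (size q == 1%N).
  by move: qy; rewrite qE map_polyC rootC /= fmorph_eq0 (negPf c0).
have [r /factor_theorem[q' qE]] := sc_closed sep_q q1.
move: sep_q qy; rewrite qE separable_root => /andP[sep_q' _].
rewrite rmorphM rootM => /orP[|].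
  apply: IHn => //; move: le_q_n.
  by rewrite qE size_Mmonic ?monicXsubC ?separable_poly_neq0 // size_XsubC addn2.
by rewrite rmorphB /= map_polyX map_polyC root_XsubC => /eqP ->; exists r.
Qed.

Lemma loc_emb_conj (x : S) (y : loc_sep L) :
  (forall p : {poly F}, root (map_poly (sc_inj S) p) x ->
     root (map_poly (sc_inj (loc_sep L)) (map_poly (cp_inj L) p)) y) ->
  exists x', emb x' = y.
Proof.
move=> xy; have [p sep_p px] := sc_separable x.
apply: (@loc_emb_root (map_poly (sc_inj S) p)); first by rewrite separable_map.
suff -> : map_poly emb (map_poly (sc_inj S) p) =
          map_poly (sc_inj (loc_sep L)) (map_poly (cp_inj L) p) by exact: xy.
by apply/polyP => i; rewrite !coef_map /= j.
Qed.

Variable s : gal (loc_sep L).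

Lemma root_locE (p : {poly F}) (y : loc_sep L) :
  root (map_poly (sc_inj (loc_sep L)) (map_poly (cp_inj L) p)) (s y) =
  root (map_poly (sc_inj (loc_sep L)) (map_poly (cp_inj L) p)) y.
Proof.
set q := map_poly _ _.
rewrite -[RHS](fmorph_root s); congr (root _ _).
by apply/polyP => i; rewrite !coef_map /= gal_fix.
Qed.

Lemma root_embE (p : {poly F}) (x : S) :
  root (map_poly (sc_inj (loc_sep L)) (map_poly (cp_inj L) p)) (emb x) =
  root (map_poly (sc_inj S) p) x.
Proof.
rewrite -[RHS](fmorph_root emb); congr (root _ _).
by apply/polyP => i; rewrite !coef_map /= j.
Qed.

Fact gal_res_ex x : exists x', emb x' = s (emb x).
Proof. by apply: (@loc_emb_conj x) => p px; rewrite root_locE root_embE. Qed.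

Definition gal_res_fun x : S := sval (cid (gal_res_ex x)).

Lemma gal_res_funE x : emb (gal_res_fun x) = s (emb x).
Proof. exact: svalP (cid (gal_res_ex x)). Qed.

Fact gal_res_zmod : zmod_morphism gal_res_fun.
Proof.
by move=> x y; apply: (fmorph_inj emb); rewrite rmorphB !gal_res_funE !rmorphB.
Qed.

Fact gal_res_monoid : monoid_morphism gal_res_fun.
Proof.
split=> [|x y]; apply: (fmorph_inj emb); first by rewrite gal_res_funE !rmorph1.
by rewrite rmorphM !gal_res_funE !rmorphM.
Qed.

HB.instance Definition _ :=
  GRing.isZmodMorphism.Build S S gal_res_fun gal_res_zmod.
HB.instance Definition _ :=
  GRing.isMonoidMorphism.Build S S gal_res_fun gal_res_monoid.

Fact gal_res_bij : bijective gal_res_fun.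
Proof.
have surj y : exists x, gal_res_fun x = y.
  have [t st ts] := gal_bij s.
  have [|x xE] := @loc_emb_conj y (t (emb y)).
    by move=> p py; rewrite -root_locE ts root_embE.
  by exists x; apply: (fmorph_inj emb); rewrite gal_res_funE xE ts.
exists (fun y => sval (cid (surj y))) => y; last exact: svalP (cid (surj y)).
by apply: (fmorph_inj (gal_res_fun : {rmorphism S -> S})); case: cid.
Qed.

Fact gal_res_fix x : gal_res_fun (sc_inj S x) = sc_inj S x.
Proof. by apply: (fmorph_inj emb); rewrite gal_res_funE !j gal_fix. Qed.

Definition gal_res : gal S :=
  @Gal _ S (gal_res_fun : {rmorphism S -> S}) gal_res_bij gal_res_fix.

End GalRes.

(** * The curves E_k and the isogeny *)

Inductive point (K : Type) := Infty | Aff of K & K.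
Arguments Infty {K}.

Definition point_map (K L : Type) (h : K -> L) (P : point K) : point L :=
  if P is Aff x y then Aff (h x) (h y) else Infty.

Section Curves.
Variable K : fieldType.
Implicit Types (k : K) (P Q : point K).

Definition curve k : set (point K) :=
  [set P | if P is Aff x y then y ^+ 2 = x ^+ 3 + k else True].

Definition padd P Q : point K :=
  match P, Q with
  | Infty, _ => Q
  | _, Infty => P
  | Aff x1 y1, Aff x2 y2 =>
    if (x1 == x2) && (y1 == - y2) then Infty else
    let m := if x1 == x2 then 3 * x1 ^+ 2 / (2 * y1)
             else (y2 - y1) / (x2 - x1) in
    let x3 := m ^+ 2 - x1 - x2 in Aff x3 (m * (x1 - x3) - y1)
  end.

Definition popp P : point K := if P is Aff x y then Aff x (- y) else Infty.

Definition psub P Q := padd P (popp Q).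

(* The rational functions have their only affine pole at x = 0. *)
Definition phihat k P : point K :=
  match P with
  | Infty => Infty
  | Aff x y =>
    if x == 0 then Infty else
    Aff ((x ^+ 3 - 108 * k) / (9 * x ^+ 2))
        (y * (x ^+ 3 + 216 * k) / (27 * x ^+ 3))
  end.

Definition ker_phihat k : set (point K) :=
  [set P | curve (- (27 * k)) P /\ phihat k P = Infty].

End Curves.

(** * Galois cohomology *)

Section Cohomology.
Variables (K : fieldType) (S : sep_closure K).

Definition cochain := gal S -> point S.

(* Continuity for the Krull topology on the source and the discrete topology
   on the target. *)
Definition krull_continuous (c : cochain) : Prop :=
  forall s : gal S, exists X : seq S,
    forall t : gal S, {in X, forall x, t x = s x} -> c t = c s.

(* The coefficient module is a Galois-stable subgroup A of the points of a
   curve y^2 = x^3 + const over S. *)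
Variable A : set (point S).

Definition cocycle : set cochain :=
  [set c | [/\ forall s, A (c s), krull_continuous c &
    forall s t, c (gal_mul s t) = padd (c s) (point_map s (c t))]].

Definition cohomologous (c c' : cochain) : Prop :=
  exists2 m, A m & forall s, c' s = padd (c s) (psub (point_map s m) m).

(* Elements of H^1 are cohomology classes, as sets of cocycles. *)
Definition h1_class (c : cochain) : set cochain :=
  [set c' | cocycle c' /\ cohomologous c c'].

Definition h1 : set (set cochain) := h1_class @` cocycle.

Definition h1_zero : set cochain := h1_class (fun=> Infty).

End Cohomology.

Definition h1_phihat (K : fieldType) (S : sep_closure K) (k : K) :
    set (set (cochain S)) :=
  h1 (ker_phihat (sc_inj S k)).

Arguments h1_phihat {K} S k _.

(* The image of the connecting map E_k(K) -> H^1(G_K, E_{-27k}[phihat]),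
   which sends phihat(Q) to the class of s |-> s(Q) - Q. *)
Definition connecting_image (K : fieldType) (S : sep_closure K) (k : K) :
    set (set (cochain S)) :=
  [set X | exists (P : point K) (Q : point S),
    [/\ curve k P, curve (- (27 * sc_inj S k)) Q,
        phihat (sc_inj S k) Q = point_map (sc_inj S) P &
        X = h1_class (ker_phihat (sc_inj S k))
              (fun s => psub (point_map s Q) Q)]].

Arguments connecting_image {K} S k _.

Section Selmer.
Variables (R : realType) (F : fieldType) (S : sep_closure F).

Definition cochain_res (v : place R F) (L : localization S v) (c : cochain S) :
    cochain (loc_sep L) :=
  fun s => point_map (loc_emb L) (c (gal_res s)).
Arguments cochain_res {v} L c _.

(* The restrictions of the cocycles in the class X all lie in one class over
   the completion, which is the union below. *)
Definition h1_res (k : F) (v : place R F) (L : localization S v)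
    (X : set (cochain S)) : set (cochain (loc_sep L)) :=
  \bigcup_(c in X)
    h1_class (ker_phihat (sc_inj (loc_sep L) (cp_inj L k))) (cochain_res L c).
Arguments h1_res k {v} L X _.

Definition selmer (loc : forall v : place R F, localization S v) (k : F) :
    set (set (cochain S)) :=
  [set X | h1_phihat S k X /\
    forall v, connecting_image (loc_sep (loc v)) (cp_inj (loc v) k)
                (h1_res k (loc v) X)].

End Selmer.

(** * Binary cubic forms *)

(* [CForm a b c d] is a u^3 + 3 b u^2 v + 3 c u v^2 + d v^3. *)
Record cform (K : Type) := CForm { cfa : K; cfb : K; cfc : K; cfd : K }.

Definition cform_map (K L : Type) (h : K -> L) (f : cform K) : cform L :=
  CForm (h (cfa f)) (h (cfb f)) (h (cfc f)) (h (cfd f)).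

Section Forms.
Variable K : fieldType.
Implicit Types (f : cform K) (g : 'M[K]_2).

Definition cfeval f (u v : K) : K :=
  cfa f * u ^+ 3 + 3 * cfb f * u ^+ 2 * v + 3 * cfc f * u * v ^+ 2
  + cfd f * v ^+ 3.

Definition cfdisc f : K :=
  let: CForm a b c d := f in
  a ^+ 2 * d ^+ 2 - 6 * a * b * c * d + 4 * a * c ^+ 3 + 4 * b ^+ 3 * d
  - 3 * b ^+ 2 * c ^+ 2.

(* Substitution of (u, v) g, a row vector times a matrix, for (u, v): see
   [cfeval_act]. *)
Definition cfact g f : cform K :=
  let: CForm a b c d := f in
  let p := g 0 0 in let q := g 0 1 in let r := g 1 0 in let s := g 1 1 in
  CForm
    (a * p ^+ 3 + 3 * b * p ^+ 2 * q + 3 * c * p * q ^+ 2 + d * q ^+ 3)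
    (a * p ^+ 2 * r + b * (p ^+ 2 * s + 2 * p * q * r)
     + c * (2 * p * q * s + q ^+ 2 * r) + d * q ^+ 2 * s)
    (a * p * r ^+ 2 + b * (2 * p * r * s + q * r ^+ 2)
     + c * (p * s ^+ 2 + 2 * q * r * s) + d * q * s ^+ 2)
    (a * r ^+ 3 + 3 * b * r ^+ 2 * s + 3 * c * r * s ^+ 2 + d * s ^+ 3).

Lemma cfeval_act g f u v :
  cfeval (cfact g f) u v =
  cfeval f (u * g 0 0 + v * g 1 0) (u * g 0 1 + v * g 1 1).
Proof. by case: f => a b c d; rewrite /cfeval /=; ring. Qed.

Lemma cfact1 f : cfact 1%:M f = f.
Proof. by case: f => a b c d; rewrite /cfact !mxE /=; congr CForm; ring. Qed.

Lemma cfactM g h f : cfact (g *m h) f = cfact g (cfact h f).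
Proof.
case: f => a b c d; rewrite /cfact !mxE !big_ord_recl !big_ord0 /=.
have -> : lift ord0 ord0 = 1 :> 'I_2 by exact/val_inj.
by rewrite !addr0; congr CForm; ring.
Qed.

Definition sl2 : set 'M[K]_2 := [set g | \det g = 1].

Definition sl2_orbit f : set (cform K) := [set cfact g f | g in sl2].

Definition sl2_stab f : set 'M[K]_2 := [set g | sl2 g /\ cfact g f = f].

(* f = (p u + q v)(r u^2 + s u v + t v^2), compared coefficientwise. *)
Definition cform_reducible f : Prop :=
  exists p q r s t : K,
    [/\ cfa f = p * r, 3 * cfb f = p * s + q * r,
        3 * cfc f = p * t + q * s & cfd f = q * t].

End Forms.

Section LocalSolubility.
Variables (R : realType) (F : fieldType) (S : sep_closure F).
Variable loc : forall v : place R F, localization S v.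

Definition locally_soluble (f : cform F) : Prop :=
  forall v, exists x y z : loc v,
    [/\ (x, y, z) != (0, 0, 0) &
        z ^+ 3 = cfeval (cform_map (cp_inj (loc v)) f) x y].

Definition soluble_orbits (k : F) : set (set (cform F)) :=
  [set sl2_orbit f | f in [set f | locally_soluble f /\ cfdisc f = 4 * k]].

End LocalSolubility.

Definition group_iso (T U : Type) (G : set T) (mulG : T -> T -> T)
    (H : set U) (mulH : U -> U -> U) : Prop :=
  exists h : T -> U, set_bij G H h /\
    forall x y, G x -> G y -> h (mulG x y) = mulH (h x) (h y).

(* Main.v *)
From mathcomp Require Import all_boot all_order all_algebra all_field.
From HB Require Import structures.
From mathcomp Require Import ring.
From mathcomp Require Import boolp classical_sets functions reals exp.
(* After all_field, whose galois.v also exports the name [gal]. *)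
Require Import Defs.

(* Over a separable closure S of a field K of characteristic not 2 or 3, all
   forms of discriminant 4k are SL_2(S)-conjugate to f0 = k u^3 + 3 u v^2, whose
   stabilizer is isomorphic, as a Galois module, to the kernel of phihat.  Since
   H^1(SL_2) is trivial, writing f = g f0 and comparing g with its conjugates
   classifies the SL_2(K)-orbits of forms of discriminant 4k by H^1 of the kernel.

   The curve z^3 = f0(x, y) is isomorphic to E_{-27k} by (x : y : z) |->
   (3 z / x, 9 y / x), and the stabilizer of f0 acts on it by translations by
   kernel points.  Hence z^3 = f(x, y) is the torsor under E_{-27k} given by the
   class of f, and it has a K-point exactly when that class comes from a K-point
   of E_k.  This holds over any K; applied to each completion of F it identifies
   local solubility with the Selmer condition. *)

Set Implicit Arguments.
Unset Strict Implicit.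
Unset Printing Implicit Defensive.

Import GRing.Theory.
Local Open Scope classical_set_scope.
Local Open Scope ring_scope.

(** * Matrices and binary cubic forms *)

Section Matrix2.
Variable K : fieldType.
Implicit Types (a b c d : K) (A : 'M[K]_2).

Definition mx2 a b c d : 'M[K]_2 := \matrix_(i, j)
  if i == 0 then (if j == 0 then a else b) else (if j == 0 then c else d).

Lemma mx2P A : exists a b c d, A = mx2 a b c d.
Proof.
exists (A 0 0), (A 0 1), (A 1 0), (A 1 1); apply/matrixP => i j; rewrite mxE.
by case: i j => [[|[|i]] Hi] [[|[|j]] Hj] //; congr (A _ _); apply/val_inj.
Qed.

Lemma mx2E a b c d : ((mx2 a b c d 0 0 = a) * (mx2 a b c d 0 1 = b) *
  (mx2 a b c d 1 0 = c) * (mx2 a b c d 1 1 = d))%type.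
Proof. by rewrite !mxE. Qed.

Lemma mx2M a b c d a' b' c' d' : mx2 a b c d *m mx2 a' b' c' d' =
  mx2 (a * a' + b * c') (a * b' + b * d') (c * a' + d * c') (c * b' + d * d').
Proof.
apply/matrixP => i j; rewrite !mxE !big_ord_recl big_ord0 !mxE addr0 /=.
by case: (i == 0); case: (j == 0).
Qed.

Lemma mx2_1 : 1%:M = mx2 1 0 0 1.
Proof.
apply/matrixP => i j; rewrite !mxE.
by case: i j => [[|[|i]] Hi] [[|[|j]] Hj] //; congr (A _ _); apply/val_inj.
Qed.

Lemma det_mx2 a b c d : \det (mx2 a b c d) = a * d - b * c.
Proof.
rewrite (expand_det_row _ 0) !big_ord_recl big_ord0 /cofactor !det_mx11 !mxE /=.
by rewrite expr0 expr1 mul1r addr0 mulN1r mulrN.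
Qed.

Lemma mx2_inj a b c d a' b' c' d' : mx2 a b c d = mx2 a' b' c' d' ->
  [/\ a = a', b = b', c = c' & d = d'].
Proof.
move=> /matrixP E; have := (E 0 0, E 0 1, E 1 0, E 1 1).
by rewrite !mx2E => -[[[]]].
Qed.

Lemma row_mul_eq0 A x y : \det A = 1 ->
  x * A 0 0 + y * A 1 0 = 0 -> x * A 0 1 + y * A 1 1 = 0 -> x = 0 /\ y = 0.
Proof.
have [a [b [c [d ->]]]] := mx2P A; rewrite det_mx2 !mx2E => D E1 E2; split.
  rewrite -[x]mulr1 -[X in _ * X]D.
  have -> : x * (a * d - b * c) = (x * a + y * c) * d - (x * b + y * d) * c by ring.
  by rewrite E1 E2 !mul0r subrr.
rewrite -[y]mulr1 -[X in _ * X]D.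
have -> : y * (a * d - b * c) = (x * b + y * d) * a - (x * a + y * c) * b by ring.
by rewrite E1 E2 !mul0r subrr.
Qed.

End Matrix2.

Lemma map_mx2 (K L : fieldType) (h : {rmorphism K -> L}) a b c d :
  map_mx h (mx2 a b c d) = mx2 (h a) (h b) (h c) (h d).
Proof. by apply/matrixP => i j; rewrite !mxE; case: (i == 0); case: (j == 0). Qed.

Lemma cfact_mx2 (K : fieldType) (p q r s a b c d : K) :
  cfact (mx2 p q r s) (CForm a b c d) = CForm
    (a * p ^+ 3 + 3 * b * p ^+ 2 * q + 3 * c * p * q ^+ 2 + d * q ^+ 3)
    (a * p ^+ 2 * r + b * (p ^+ 2 * s + 2 * p * q * r)
     + c * (2 * p * q * s + q ^+ 2 * r) + d * q ^+ 2 * s)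
    (a * p * r ^+ 2 + b * (2 * p * r * s + q * r ^+ 2)
     + c * (p * s ^+ 2 + 2 * q * r * s) + d * q * s ^+ 2)
    (a * r ^+ 3 + 3 * b * r ^+ 2 * s + 3 * c * r * s ^+ 2 + d * s ^+ 3).
Proof. by rewrite /cfact !mx2E. Qed.

Lemma cfdisc_act (K : fieldType) (g : 'M[K]_2) f :
  \det g = 1 -> cfdisc (cfact g f) = cfdisc f.
Proof.
have [p [q [r [s ->]]]] := mx2P g; case: f => a b c d; rewrite det_mx2 => det1.
rewrite -[RHS]mul1r -(expr1n _ 6) -[X in X ^+ 6]det1 cfact_mx2 /=.
ring.
Qed.

Lemma cform_mapE (K L : Type) (h : K -> L) a b c d :
  cform_map h (CForm a b c d) = CForm (h a) (h b) (h c) (h d).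
Proof. by []. Qed.

Lemma cform_map_act (K L : fieldType) (h : {rmorphism K -> L}) (g : 'M[K]_2) f :
  cform_map h (cfact g f) = cfact (map_mx h g) (cform_map h f).
Proof.
have [p [q [r [s ->]]]] := mx2P g; case: f => a b c d.
rewrite map_mx2 cfact_mx2 !cform_mapE cfact_mx2.
by congr CForm; rewrite !(rmorph_nat, rmorphXn, rmorphM, rmorphD).
Qed.

Lemma cfeval_map (K L : fieldType) (h : {rmorphism K -> L}) f x y :
  h (cfeval f x y) = cfeval (cform_map h f) (h x) (h y).
Proof.
by case: f => a b c d; rewrite /cfeval /= !(rmorph_nat, rmorphXn, rmorphM, rmorphD).
Qed.

Lemma cfevalZ (K : fieldType) (f : cform K) l x y :
  cfeval f (l * x) (l * y) = l ^+ 3 * cfeval f x y.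
Proof. by rewrite /cfeval; ring. Qed.

Lemma cfdisc_map (K L : fieldType) (h : {rmorphism K -> L}) f :
  cfdisc (cform_map h f) = h (cfdisc f).
Proof.
by case: f => a b c d /=; rewrite !(rmorph_nat, rmorphXn, rmorphM, rmorphN, rmorphD).
Qed.

Section Maps.
Variables (K L : fieldType) (h : {rmorphism K -> L}).
Implicit Types (k : K) (P Q : point K).

Lemma point_map_inj : injective (point_map h).
Proof. by move=> [|x y] [|x' y'] //= [/fmorph_inj -> /fmorph_inj ->]. Qed.

Lemma point_mapN P : point_map h (popp P) = popp (point_map h P).
Proof. by case: P => //= x y; rewrite rmorphN. Qed.

Lemma curve_map k P : curve (h k) (point_map h P) <-> curve k P.
Proof.
case: P => //= x y; rewrite -!rmorphXn -rmorphD; split=> [/fmorph_inj //|->//].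
Qed.

Lemma phihat_map k P : phihat (h k) (point_map h P) = point_map h (phihat k P).
Proof.
case: P => //= x y; rewrite fmorph_eq0; case: ifP => //= _.
by rewrite !(rmorph_nat, rmorphXn, fmorphV, rmorphM, rmorphN, rmorphD).
Qed.

Lemma ker_phihat_map k P : ker_phihat (h k) (point_map h P) <-> ker_phihat k P.
Proof.
rewrite /ker_phihat /= phihat_map.
have -> : - (27 * h k) = h (- (27 * k)) by rewrite rmorphN rmorphM rmorph_nat.
split=> -[/curve_map ? H]; split=> //; last by rewrite H.
by apply: point_map_inj; rewrite H.
Qed.

End Maps.

Definition form0 (K : fieldType) (k : K) : cform K := CForm k 0 1 0.

Lemma num23_neq0 (K : fieldType) : (2 : K) != 0 -> (3 : K) != 0 ->
  ((4 : K) != 0) * ((6 : K) != 0) * ((8 : K) != 0) * ((9 : K) != 0) *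
  ((12 : K) != 0) * ((18 : K) != 0) * ((27 : K) != 0) * ((36 : K) != 0) *
  ((54 : K) != 0) * ((108 : K) != 0).
Proof.
move=> n2 n3.
have num i j : ((2 ^ i * 3 ^ j)%N%:R : K) != 0.
  by rewrite natrM !natrX mulf_neq0 ?expf_neq0.
exact: (num 2 0, num 1 1, num 3 0, num 0 2, num 2 1, num 1 2, num 0 3, num 2 2,
  num 1 3, num 2 3)%N.
Qed.

Section Kernel.
Variables (K : fieldType) (k : K).
Hypotheses (n2 : (2 : K) != 0) (n3 : (3 : K) != 0) (k0 : k != 0).
Local Notation A := (ker_phihat k).
Local Notation f0 := (form0 k).

Let nz := (oppr_eq0, oner_neq0 K, n2, n3, num23_neq0 n2 n3).

(* The action of a kernel point on the form [form0 k]; on the curve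
   z^3 = form0 k (x, y) it is translation by that point, by
   [padd_cubic_point]. *)
Definition ker_mx (P : point K) : 'M[K]_2 :=
  if P is Aff _ y then mx2 (- 2^-1) (y / (2 * 3)) (y / (2 * 3 * k)) (- 2^-1) else 1%:M.

Lemma kerP P : A P <-> P = Infty \/ exists2 y, y ^+ 2 = - (27 * k) & P = Aff 0 y.
Proof.
split=> [[]|[->|[y yE ->]]]; last 2 first.
- by [].
- by split; rewrite /= ?eqxx // yE expr0n add0r.
case: P => [|x y] /=; first by left.
case: eqP => // -> + _; rewrite expr0n add0r => yE; right; by exists y.
Qed.

Lemma ker_aff_neq0 y : y ^+ 2 = - (27 * k) -> y != 0.
Proof.
move=> yE; have /= <- := expf_eq0 y 2; rewrite yE oppr_eq0.
have -> : 27 * k = 3 ^+ 3 * k by ring.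
by rewrite mulf_neq0 // expf_neq0.
Qed.

Lemma ker_const y : y ^+ 2 = - (27 * k) -> k = - (y ^+ 2 / 3 ^+ 3).
Proof.
by move=> ->; field; rewrite nz.
Qed.

Lemma ker_sqr_eq y y' : y ^+ 2 = - (27 * k) -> y' ^+ 2 = - (27 * k) -> y' = y \/ y' = - y.
Proof.
by move=> <- /eqP; rewrite eqf_sqr => /orP[]/eqP; [left|right].
Qed.

Lemma neq_opp (y : K) : y != 0 -> (y == - y) = false.
Proof.
move=> y0; apply: contraNF y0; rewrite -addr_eq0 => /eqP E.
by apply/eqP/(mulfI n2); rewrite mulr0 -{}E; ring.
Qed.

Lemma ker_add_self y : y ^+ 2 = - (27 * k) -> padd (Aff 0 y) (Aff 0 y) = Aff 0 (- y).
Proof.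
move=> /ker_aff_neq0 y0; rewrite /= eqxx neq_opp //= expr0n mulr0 mul0r expr0n /=.
by rewrite !subr0 mul0r sub0r.
Qed.

Lemma ker_mx_mul P Q : A P -> A Q ->
  A (padd P Q) /\ ker_mx (padd P Q) = ker_mx P *m ker_mx Q.
Proof.
move=> /kerP[->|[y yE ->]] AQ; first by rewrite /= mul1mx.
have k9 := ker_const yE.
have y0 := ker_aff_neq0 yE.
move/kerP: AQ => [->|[y' yE' ->]].
  by rewrite /= mulmx1; split=> //; apply/kerP; right; exists y.
have [->|->] := ker_sqr_eq yE yE'.
  rewrite ker_add_self //; split; first by apply/kerP; right; exists (- y); rewrite ?sqrrN.
  by rewrite /= mx2M k9; congr mx2; field; rewrite ?nz ?expf_neq0 ?y0.
rewrite /= eqxx opprK eqxx /=; split; first by apply/kerP; left.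
by rewrite mx2M mx2_1 k9; congr mx2; field; rewrite ?nz ?expf_neq0 ?y0.
Qed.

Lemma ker_opp P : A P -> A (popp P).
Proof.
move=> /kerP[->|[y yE ->]]; apply/kerP; first by left.
by right; exists (- y); rewrite ?sqrrN.
Qed.

Lemma padd_opp (P : point K) : padd P (popp P) = Infty.
Proof. by case: P => //= x y; rewrite eqxx opprK eqxx. Qed.

Lemma ker_mx_det P : A P -> \det (ker_mx P) = 1.
Proof.
move=> /kerP[->|[y yE ->]] /=; first by rewrite det1.
have k9 := ker_const yE.
by rewrite det_mx2 k9; field; rewrite ?nz ?expf_neq0 ?(ker_aff_neq0 yE).
Qed.

Lemma ker_mxN P : A P -> ker_mx (popp P) *m ker_mx P = 1%:M.
Proof.
move=> AP; have [_ <-] := ker_mx_mul (ker_opp AP) AP.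
suff -> : padd (popp P) P = Infty by [].
by case: (P) => //= x y; rewrite !eqxx.
Qed.

Lemma ker_mx_inj P Q : A P -> A Q -> ker_mx P = ker_mx Q -> P = Q.
Proof.
have N1 y : mx2 (- 2^-1) (y / (2 * 3)) (y / (2 * 3 * k)) (- 2^-1) <> 1%:M.
  rewrite mx2_1 => /mx2_inj[/eqP + _ _ _]; apply/negP.
  rewrite -subr_eq0 (_ : _ - _ = - (3 / 2)); last by field.
  by rewrite oppr_eq0 mulf_neq0 ?invr_eq0.
move=> /kerP[->|[y yE ->]] /kerP[->|[y' yE' ->]] //=; first by move/esym/N1.
  by move/N1.
move/mx2_inj => [_ /mulIf -> //].
by rewrite invr_eq0 mulf_neq0.
Qed.

Lemma ker_mx_act P : A P -> cfact (ker_mx P) f0 = f0.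
Proof.
move=> /kerP[->|[y yE ->]]; first by rewrite cfact1.
have k9 := ker_const yE.
have y0 := ker_aff_neq0 yE.
rewrite /ker_mx /form0 cfact_mx2 k9; congr CForm; field; rewrite ?nz ?expf_neq0 ?y0 //.
Qed.

Lemma stab_form0 g : \det g = 1 -> cfact g f0 = f0 -> exists2 P, A P & g = ker_mx P.
Proof.
have [p [q [r [s ->]]]] := mx2P g; rewrite det_mx2 cfact_mx2 => D [_ E2 E3 E4].
have {}E2 : k * p ^+ 2 * r + (2 * p * q * s + q ^+ 2 * r) = 0 by rewrite -[RHS]E2; ring.
have {}E3 : k * p * r ^+ 2 + (p * s ^+ 2 + 2 * q * r * s) = 1 by rewrite -[RHS]E3; ring.
have /eqP : r * (k * r ^+ 2 + 3 * s ^+ 2) = 0 by rewrite -[RHS]E4; ring.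
rewrite mulf_eq0 => /orP[/eqP r0|/eqP E5].
  rewrite {}r0 in D E2 E3 *; exists Infty; first by apply/kerP; left.
  have ps : p * s = 1 by rewrite -D; ring.
  have s1 : s = 1 by rewrite -[LHS]mul1r -[in LHS]ps -[RHS]E3; ring.
  rewrite {}s1 in ps E2 *; have p1 : p = 1 by rewrite -ps mulr1.
  rewrite {}p1 in E2 *; suff -> : q = 0 by rewrite /= mx2_1.
  by apply: (mulfI n2); rewrite mulr0 -[RHS]E2; ring.
have kr : k * r ^+ 2 = - (3 * s ^+ 2) by apply/eqP; rewrite -addr_eq0 E5.
have sE : s = - 2^-1.
  have : - (2 * s) = 1.
    have : p * (k * r ^+ 2) + (p * s ^+ 2 + 2 * q * r * s) = 1 by rewrite -[RHS]E3; ring.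
    rewrite kr => h; rewrite -[RHS]h.
    apply: etrans (_ : - (2 * s) * (p * s - q * r) = _); last by ring.
    by rewrite D mulr1.
  by move=> h; apply: (mulfI n2); rewrite mulrN mulfV // -[in RHS]h opprK.
rewrite sE in D E2 kr *.
have kr2 : k * r ^+ 2 = - (3 / 2 ^+ 2) by rewrite kr; field; rewrite ?nz.
have r0 : r != 0.
  apply: contra_eq_neq kr2 => ->; rewrite expr0n mulr0 eq_sym oppr_eq0.
  by rewrite mulf_neq0 ?invr_eq0 ?expf_neq0.
have kE : k = - (3 / (2 ^+ 2 * r ^+ 2)).
  by apply: (mulIf (expf_neq0 2 r0)); rewrite kr2; field; rewrite ?nz ?expf_neq0 ?r0.
have pE : p = - 2 - 2 * (q * r).
  have : p * 2^-1 = - (p * - 2^-1 - q * r) - q * r by ring.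
  rewrite D.
  by move=> h; rewrite -[LHS](mulfVK n2) h; ring.
have qE : q = k * r.
  have h : r * (2 ^+ 2 * (k * p ^+ 2 * r + (2 * p * q * - 2^-1 + q ^+ 2 * r))) = 0.
    by rewrite E2 !mulr0.
  have : - (2 ^+ 2 * (q * r)) = 3.
    apply/eqP; rewrite -subr_eq0; apply/eqP; rewrite -[RHS](mulr0 (2 ^+ 2)^-1) -[in RHS]h pE kE.
    by field; rewrite ?nz ?expf_neq0 ?r0.
  by move=> h'; apply: (mulIf r0); rewrite kE; apply: (mulfI (expf_neq0 2 n2));
     apply: oppr_inj; rewrite h'; field; rewrite ?nz ?expf_neq0 ?r0.
exists (Aff 0 (2 * 3 * (k * r))).
  apply/kerP; right; exists (2 * 3 * (k * r)) => //.
  by rewrite [in LHS]kE [in RHS]kE; field; rewrite ?nz ?expf_neq0 ?r0.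
rewrite /= pE qE; congr mx2; try by field; rewrite ?nz ?expf_neq0 ?r0 ?k0.
by rewrite kE; field; rewrite ?nz ?expf_neq0 ?r0.
Qed.

Lemma cfdisc_form0 : cfdisc f0 = 4 * k.
Proof. by rewrite /=; ring. Qed.

Lemma root_form0_orbit f u v : cfdisc f = 4 * k -> (u, v) != (0, 0) -> cfeval f u v = 0 ->
  exists2 g : 'M[K]_2, \det g = 1 & cfact g f0 = f.
Proof.
move=> df uv fuv.
have [h [deth h10 h11]] : exists h : 'M[K]_2, [/\ \det h = 1, h 1 0 = u & h 1 1 = v].
  have [v0|v0] := eqVneq v 0.
    have u0 : u != 0 by move: uv; rewrite v0; apply: contraNneq => ->.
    by exists (mx2 0 (- u^-1) u v); rewrite !mx2E det_mx2; split=> //; field; rewrite ?nz.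
  by exists (mx2 v^-1 0 u v); rewrite !mx2E det_mx2; split=> //; field; rewrite ?nz.
have uh : h \in unitmx by rewrite unitmxE deth unitr1.
suff [g detg gE] : exists2 g : 'M[K]_2, \det g = 1 & cfact g f0 = cfact h f.
  exists (invmx h *m g); first by rewrite det_mulmx det_inv deth invr1 mul1r.
  by rewrite cfactM gE -cfactM mulVmx // cfact1.
have : cfdisc (cfact h f) = 4 * k by rewrite cfdisc_act.
have : cfd (cfact h f) = 0.
  by rewrite -[RHS]fuv -h10 -h11; case: (f) => a b c d; rewrite /cfeval /=; ring.
case: (cfact h f) => a b c d /= -> dE.
have c0 : c != 0.
  apply: contra_neq k0 => cE; apply: (mulfI (expf_neq0 2 n2)).
  have -> : 2 ^+ 2 * k = 4 * k by ring.
  by rewrite -dE cE; ring.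
suff gE : cfact (mx2 c^-1 (b / 2) 0 c) f0 = CForm a b c 0.
  exists (mx2 c^-1 (b / 2) 0 c); last exact: gE.
  by rewrite det_mx2; field; rewrite ?nz.
have kE : k = a * c ^+ 3 - 3 / 2 ^+ 2 * b ^+ 2 * c ^+ 2.
  apply: (mulfI (expf_neq0 2 n2)); have -> : 2 ^+ 2 * k = 4 * k by ring.
  by rewrite -dE; field; rewrite ?nz.
rewrite /form0 cfact_mx2 kE; congr CForm; field; rewrite ?nz ?expf_neq0 ?c0 //.
Qed.

Lemma reducible_form0_orbit f : cfdisc f = 4 * k -> cform_reducible f ->
  exists2 g : 'M[K]_2, \det g = 1 & cfact g f0 = f.
Proof.
move=> df [p [q [r [s [t [fa fb fc fd]]]]]].
have fE u v : cfeval f u v = (p * u + q * v) * (r * u ^+ 2 + s * u * v + t * v ^+ 2).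
  by rewrite /cfeval fa fb fc fd; ring.
apply: (root_form0_orbit (u := - q) (v := p)); rewrite // ?fE; last by ring.
rewrite xpair_eqE oppr_eq0; apply/negP => /andP[/eqP q0 /eqP p0].
case: f df fa fb fc fd {fE} => a b c d /= df fa fb fc fd.
have a0 : a = 0 by rewrite fa p0 mul0r.
have d0 : d = 0 by rewrite fd q0 mul0r.
have b0 : b = 0 by apply: (mulfI n3); rewrite fb p0 q0 !mul0r addr0 mulr0.
move: df; rewrite a0 d0 b0 => df; case/eqP: k0; apply: (mulfI (expf_neq0 2 n2)).
have -> : 2 ^+ 2 * k = 4 * k by ring.
by rewrite -df; ring.
Qed.

Lemma form0_orbit_reducible g : cform_reducible (cfact g f0).
Proof.
have [p [q [r [s ->]]]] := mx2P g; rewrite /form0 cfact_mx2.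
exists p, r, (k * p ^+ 2 + 3 * q ^+ 2), (2 * k * p * r + 2 * 3 * q * s),
  (k * r ^+ 2 + 3 * s ^+ 2); split=> /=; ring.
Qed.

End Kernel.

Lemma ker_mx_map (K L : fieldType) (h : {rmorphism K -> L}) k P :
  ker_mx (h k) (point_map h P) = map_mx h (ker_mx k P).
Proof.
case: P => [|x y] /=; first by rewrite map_mx1.
by rewrite map_mx2 !(rmorph_nat, fmorphV, rmorphM, rmorphN).
Qed.

Lemma sep_form0_orbit (K : fieldType) (S : sep_closure K) (k : S) f :
  (2 : S) != 0 -> (3 : S) != 0 -> k != 0 -> cfdisc f = 4 * k ->
  exists2 g : 'M[S]_2, \det g = 1 & cfact g (form0 k) = f.
Proof.
move=> n2 n3 k0 df.
suff [u [v [uv fuv]]] : exists u v, (u, v) != (0, 0) /\ cfeval f u v = 0.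
  exact: root_form0_orbit uv fuv.
case: f df => a b c d df.
have [a0|a0] := eqVneq a 0.
  by exists 1, 0; rewrite xpair_eqE oner_eq0 /cfeval /= a0; split=> //; ring.
have disc0 : cfdisc (CForm a b c d) != 0.
  rewrite df mulf_neq0 //; have -> : 4 = 2 ^+ 2 :> S by ring.
  by rewrite expf_neq0.
pose X : {poly S} := 'X.
(* q and r are the dehomogenized partial derivatives of the form, up to a
   factor 3. *)
pose q := a%:P * X ^+ 2 + (2 * b)%:P * X + c%:P.
pose r := b%:P * X ^+ 2 + (2 * c)%:P * X + d%:P.
pose p := a%:P * X ^+ 3 + (3 * b)%:P * X ^+ 2 + (3 * c)%:P * X + d%:P.
have pE : p = X * q + r by rewrite /p /q /r !polyCM !polyC_natr; ring.
have p'E : p^`() = 3%:P * q.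
  rewrite /p !(derivD, derivM, derivC, derivXn, derivX) /q !polyCM !polyC_natr /=.
  rewrite -/X; ring.
have sep_p : separable_poly p.
  rewrite unlock; apply/coprimepP => e ep; rewrite p'E mul_polyC dvdpZr // => eq.
  have er : e %| r by move: ep; rewrite pE dvdp_addr // dvdp_mull.
  have eXd : e %| (cfdisc (CForm a b c d))%:P * X.
    have -> : (cfdisc (CForm a b c d))%:P * X =
        2 * (b ^+ 2 - a * c)%:P * (d%:P * q - c%:P * r) -
        (a * d - b * c)%:P * X * (b%:P * q - a%:P * r).
      rewrite /= /q /r !(polyCD, polyCN, polyCM, polyC_exp, polyC_natr); ring.
    by rewrite dvdp_sub // dvdp_mull // dvdp_sub // dvdp_mull.
  have {}eX : e %| X by rewrite mul_polyC dvdpZr in eXd.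
  have ec : e %| c%:P.
    have -> : c%:P = q - (a%:P * X + (2 * b)%:P) * X by rewrite /q; ring.
    by rewrite dvdp_sub // dvdp_mull.
  have ed : e %| d%:P.
    have -> : d%:P = r - (b%:P * X + (2 * c)%:P) * X by rewrite /r; ring.
    by rewrite dvdp_sub // dvdp_mull.
  have e1 (z : S) : z != 0 -> e %| z%:P -> e %= 1.
    by move=> z0; rewrite -[z%:P]mulr1 mul_polyC dvdpZr // dvdp1 -size_poly_eq1.
  have [c0|c0] := eqVneq c 0; last exact: e1 ec.
  apply: e1 ed; apply: contraNneq disc0 => d0; rewrite /= c0 d0; apply/eqP; ring.
have [|x px] := sc_closed sep_p.
  have p3 : p`_3 = a by rewrite /p !coefD !coefCM !coefXn coefX coefC /= !mulr0 !addr0 mulr1.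
  apply/negP => /eqP sp; move: a0; rewrite -p3 nth_default ?eqxx // sp //.
exists x, 1; rewrite xpair_eqE oner_eq0 andbF; split=> //.
by rewrite -[RHS](eqP px) /cfeval /p !hornerE /=; ring.
Qed.

(** * Galois theory of a separable closure *)

Section MinimalPolynomial.
Variables (L S : fieldType).
Implicit Types (i : {rmorphism L -> S}) (m p q : {poly L}) (a : S).

Lemma ex_minpoly i a p : p != 0 -> root (map_poly i p) a ->
  exists2 m, m != 0 & forall q, root (map_poly i q) a = (m %| q).
Proof.
move=> p0 pa; pose T n := `[< exists q, [/\ q != 0, root (map_poly i q) a & size q = n] >].
have exT : exists n, T n by exists (size p); apply/asboolP; exists p.
case: (ex_minnP exT) => n /asboolP[m [m0 ma szm]] nmin.
exists m => // q; apply/idP/idP => [qa|/dvdpP[r ->]]; last first.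
  by rewrite rmorphM /= rootM ma orbT.
rewrite /dvdp; apply/eqP/eqP; apply: contraT => r0.
have ra : root (map_poly i (q %% m)) a.
  move: qa; rewrite {1}(divp_eq q m) rmorphD rmorphM /root /= hornerD hornerM.
  by rewrite (eqP ma) mulr0 add0r.
have /nmin : T (size (q %% m)) by apply/asboolP; exists (q %% m).
by rewrite -szm leqNgt ltn_modp m0.
Qed.

Lemma coprimep_minpoly i a m q : m != 0 ->
  (forall q, root (map_poly i q) a = (m %| q)) -> ~~ (m %| q) -> coprimep m q.
Proof.
move=> m0 mP mq; have /dvdpP[r mE] := dvdp_gcdl m q.
have := dvdpp m; rewrite -mP {1}mE rmorphM rootM !mP /=.
have gq : gcdp m q %| q by exact: dvdp_gcdr.
case/orP => [mr|mg]; last by rewrite (dvdp_trans mg gq) in mq.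
have r0 : r != 0 by apply: contraNneq m0 => r0; rewrite mE r0 mul0r.
have g0 : gcdp m q != 0 by rewrite gcdp_eq0 negb_and m0.
rewrite coprimep_def eqn_leq; apply/andP; split; last by rewrite lt0n size_poly_eq0.
have := dvdp_leq r0 mr; rewrite {1}mE size_mul //.
have := r0; rewrite -size_poly_eq0; case: (size r) => // n _.
by rewrite addSn /= -[leqRHS]addn1 leq_add2l.
Qed.

Lemma conj_minpoly i (j : {rmorphism L -> S}) a b m : m != 0 ->
  (forall q, root (map_poly i q) a = (m %| q)) -> root (map_poly j m) b ->
  (forall q, root (map_poly j q) b = (m %| q)) /\
  (forall q, ~~ (m %| q) -> exists u,
     (map_poly i u).[a] = (map_poly i q).[a]^-1 /\
     (map_poly j u).[b] = (map_poly j q).[b]^-1).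
Proof.
move=> m0 mP mb.
have bez q : ~~ (m %| q) -> exists u,
    (map_poly i u).[a] * (map_poly i q).[a] = 1 /\
    (map_poly j u).[b] * (map_poly j q).[b] = 1.
  move=> /(coprimep_minpoly m0 mP)/Bezout_eq1_coprimepP[[v u] /= uv].
  have ma : root (map_poly i m) a by rewrite mP.
  have ev (h : {rmorphism L -> S}) c : root (map_poly h m) c ->
      (map_poly h u).[c] * (map_poly h q).[c] = 1.
    move/eqP=> mc; have := congr1 (fun p => (map_poly h p).[c]) uv.
    by rewrite rmorphD !rmorphM rmorph1 hornerD !hornerM mc mulr0 add0r hornerC.
  by exists u; split; apply: ev.
split=> q.
  apply/idP/idP => [qb|/dvdpP[r ->]]; last by rewrite rmorphM /= rootM mb orbT.
  apply: contraT => /bez[u [_]]; rewrite (eqP qb) mulr0 => /esym/eqP.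
  by rewrite oner_eq0.
have inv (x y : S) : x * y = 1 -> x = y^-1.
  by move=> xy; rewrite -[LHS]divr1 -xy invfM mulrA mulfV ?mul1r //;
     apply: contra_eq_neq xy => ->; rewrite mul0r eq_sym oner_eq0.
by move=> /bez[u [/inv ? /inv ?]]; exists u.
Qed.

End MinimalPolynomial.

(* Automorphisms of [S] over [K] are built as maximal elements among graphs of
   isomorphisms between subfields of [S]; a graph is a subfield of the ring
   [S * S], and this description is symmetric in the two factors. *)
Section PartialIso.
Variables (K : fieldType) (S : sep_closure K).

Record iso_graph (G : set (S * S)) : Prop := IsoGraph {
  graph_base : forall x, G (sc_inj S x, sc_inj S x);
  graphB : forall x y, G x -> G y -> G (x - y);
  graphM : forall x y, G x -> G y -> G (x * y);
  graphV : forall x, G x -> G (x.1^-1, x.2^-1);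
  graph_eq0 : forall x, G x -> (x.1 == 0) = (x.2 == 0) }.

Record piso := Piso { piso_set : set (S * S); pisoP : iso_graph piso_set }.

Section GraphField.
Variable G : piso.

Definition graph_pred : {pred S * S} := fun x => `[< piso_set G x >].

Fact graph_subring : subring_closed graph_pred.
Proof.
split=> [|x y /asboolP Gx /asboolP Gy|x y /asboolP Gx /asboolP Gy]; apply/asboolP.
- by have := graph_base (pisoP G) 1; rewrite rmorph1.
- exact: (graphB (pisoP G)).
- exact: (graphM (pisoP G)).
Qed.

HB.instance Definition _ := GRing.isSubringClosed.Build _ graph_pred graph_subring.

Record graph := Graph { graph_val : S * S; _ : graph_val \in graph_pred }.
HB.instance Definition _ := [isSub for graph_val].
HB.instance Definition _ := [Choice of graph by <:].
HB.instance Definition _ := [SubChoice_isSubComNzRing of graph by <:].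

Fact graph_inv_subproof (x : graph) :
  ((val x).1^-1, (val x).2^-1) \in graph_pred.
Proof. by case: x => x /= /asboolP Gx; apply/asboolP/(graphV (pisoP G)). Qed.

Definition graph_inv (x : graph) : graph := Graph (graph_inv_subproof x).

Fact graph_mulVf x : x != 0 -> graph_inv x * x = 1.
Proof.
move=> x0; apply/val_inj; rewrite rmorphM rmorph1 /= -[graph_val x]/(val x).
have /asboolP Gx := valP x; have := graph_eq0 (pisoP G) Gx.
have : val x != 0 by [].
case: (val x) => a b /= ab0 E.
have b0 : b != 0 by apply: contraNneq ab0 => b0; move: E; rewrite b0 eqxx => /eqP ->.
have a0 : a != 0 by rewrite E.
by apply: injective_projections; apply: mulVf.
Qed.

Fact graph_inv0 : graph_inv 0 = 0.
Proof. by apply/val_inj; rewrite /= !invr0. Qed.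

HB.instance Definition _ := GRing.ComNzRing_isField.Build graph graph_mulVf graph_inv0.

Definition graph_fst : {rmorphism graph -> S} := fst \o val.
Definition graph_snd : {rmorphism graph -> S} := snd \o val.

Lemma graphP x y : piso_set G (x, y) ->
  exists z : graph, graph_fst z = x /\ graph_snd z = y.
Proof. by move=> Gxy; exists (Graph (asboolT Gxy : (x, y) \in graph_pred)). Qed.

End GraphField.

Definition adjoin_graph (L : fieldType) (i j : {rmorphism L -> S}) a b : set (S * S) :=
  [set z | exists q : {poly L}, z = ((map_poly i q).[a], (map_poly j q).[b])].

Lemma adjoin_graphC (L : fieldType) (i j : {rmorphism L -> S}) a b l :
  adjoin_graph i j a b (i l, j l).
Proof. by exists l%:P; rewrite !map_polyC !hornerC. Qed.

Lemma adjoin_graphX (L : fieldType) (i j : {rmorphism L -> S}) a b :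
  adjoin_graph i j a b (a, b).
Proof. by exists 'X; rewrite !map_polyX !hornerX. Qed.

Lemma iso_graph_adjoin (L : fieldType) (i j : {rmorphism L -> S}) a b m :
  (forall x, exists l, i l = sc_inj S x /\ j l = sc_inj S x) ->
  m != 0 -> (forall q, root (map_poly i q) a = (m %| q)) ->
  root (map_poly j m) b ->
  iso_graph (adjoin_graph i j a b).
Proof.
move=> base m0 mP mb; have [mP' inv] := conj_minpoly m0 mP mb; split.
- by move=> x; have [l [il jl]] := base x; have := adjoin_graphC i j a b l; rewrite il jl.
- move=> _ _ [p ->] [q ->]; exists (p - q).
  by rewrite !rmorphB /= !hornerD !hornerN.
- by move=> _ _ [p ->] [q ->]; exists (p * q); rewrite !rmorphM /= !hornerM.
- move=> _ [q ->] /=; have [mq|/inv[u [<- <-]]] := boolP (m %| q); last by exists u.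
  exists 0; rewrite !rmorph0 !horner0.
  have /eqP -> : root (map_poly i q) a by rewrite mP.
  have /eqP -> : root (map_poly j q) b by rewrite mP'.
  by rewrite invr0.
- move=> _ [q ->] /=; exact: etrans (mP q) (esym (mP' q)).
Qed.

Lemma separable_minpoly (L : fieldType) (i : {rmorphism L -> S}) a :
  (forall x, exists l, i l = sc_inj S x) ->
  exists m, [/\ m != 0, (forall q, root (map_poly i q) a = (m %| q)) &
    separable_poly m].
Proof.
move=> base; have [p sep_p pa] := sc_separable a.
have [c cE] : {c : K -> L | forall x, i (c x) = sc_inj S x}.
  by exists (fun x => sval (cid (base x))) => x; case: cid.
have cZ : zmod_morphism c by move=> x y; apply: (fmorph_inj i); rewrite rmorphB !cE rmorphB.
have cM : monoid_morphism c.
  by split=> [|x y]; apply: (fmorph_inj i); rewrite !(cE, rmorph1, rmorphM).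
pose cz := GRing.isZmodMorphism.Build K L c cZ.
pose cm := GRing.isMonoidMorphism.Build K L c cM.
pose C : {rmorphism K -> L} := HB.pack c cz cm.
have sep_q : separable_poly (map_poly C p) by rewrite separable_map.
have qa : root (map_poly i (map_poly C p)) a.
  rewrite -map_poly_comp (eq_map_poly (g := sc_inj S)) // => x; exact: cE.
have [m m0 mP] := ex_minpoly (separable_poly_neq0 sep_q) qa.
by exists m; split=> //; apply: dvdp_separable sep_q; rewrite -mP.
Qed.

Lemma piso_extend (G : piso) a :
  exists2 H : piso, piso_set G `<=` piso_set H & exists b, piso_set H (a, b).
Proof.
have base x : exists l : graph G, graph_fst G l = sc_inj S x /\ graph_snd G l = sc_inj S x.
  exact: graphP (graph_base (pisoP G) x).
have [|m [m0 mP sep_m]] := @separable_minpoly (graph G) (graph_fst G) a.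
  by move=> x; have [l []] := base x; exists l.
have m1 : size m != 1%N.
  apply/negP => /size_poly1P[c c0 mE].
  by have := dvdpp m; rewrite -mP mE map_polyC rootC fmorph_eq0 (negPf c0).
have [||b mb] := @sc_closed _ S (map_poly (graph_snd G) m).
- by rewrite separable_map.
- by rewrite size_map_poly.
exists (Piso (iso_graph_adjoin base m0 mP mb)).
  by move=> [x y] /graphP[l [<- <-]]; apply: adjoin_graphC.
by exists b; apply: adjoin_graphX.
Qed.

Lemma piso_maximal (G : piso) : exists2 H : piso, piso_set G `<=` piso_set H &
  forall H' : piso, piso_set H `<=` piso_set H' -> piso_set H' `<=` piso_set H.
Proof.
have [|A [GA maxA]] := @Zorn_bigcup _ [set A | iso_graph (piso_set G `|` A)].
  move=> C CP Ctot /=; set U := _ `|` _.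
  pose T := [set set0] `|` C.
  have TP A : T A -> iso_graph (piso_set G `|` A).
    by move=> [->|/CP//]; rewrite setU0; apply: pisoP.
  have UP z : U z -> exists2 A, T A & (piso_set G `|` A) z.
    by move=> [Gz|[A CA Az]]; [exists set0; left|exists A; right].
  have TU A : T A -> piso_set G `|` A `<=` U.
    move=> [->|CA]; first by rewrite setU0; apply: subsetUl.
    by move=> z [Gz|Az]; [left|right; exists A].
  have UP2 z z' : U z -> U z' ->
      exists2 A, T A & (piso_set G `|` A) z /\ (piso_set G `|` A) z'.
    move=> /UP[A TA Az] /UP[B TB Bz'].
    have [AB|BA] : A `<=` B \/ B `<=` A.
      case: TA TB => [->|CA] [->|CB]; do ?by [left; apply: sub0set|right; apply: sub0set].
      exact: Ctot.
      by exists B => //; split=> //; case: Az => [?|/AB]; [left|right].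
    by exists A => //; split=> //; case: Bz' => [?|/BA]; [left|right].
  split.
  - by move=> x; left; exact: (graph_base (pisoP G) x).
  - move=> x y Ux Uy; have [A TA [Ax Ay]] := UP2 _ _ Ux Uy.
    exact/(TU A)/(graphB (TP A TA)).
  - move=> x y Ux Uy; have [A TA [Ax Ay]] := UP2 _ _ Ux Uy.
    exact/(TU A)/(graphM (TP A TA)).
  - by move=> x /UP[A TA Ax]; apply/(TU A)/(graphV (TP A TA)).
  - by move=> x /UP[A TA Ax]; apply: (graph_eq0 (TP A TA)).
exists (Piso GA) => /= [|H GH]; first exact: subsetUl.
move=> z Hz; apply: contrapT => GAz.
have HE : piso_set G `|` piso_set H = piso_set H.
  by apply/setUidPr => x Gx; apply: GH; left.
apply: (maxA (piso_set H)); last by rewrite /= HE; apply: pisoP.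
split; first by move=> x Ax; apply: GH; right.
by move=> HA; apply: GAz; right; apply: HA.
Qed.

Fact iso_graph_swap (G : piso) : iso_graph [set z | piso_set G (z.2, z.1)].
Proof.
case: G => G /= [g1 g2 g3 g4 g5]; split=> //=.
- by move=> [x x'] [y y'] /= Gx Gy; have := g2 _ _ Gx Gy.
- by move=> [x x'] [y y'] /= Gx Gy; have := g3 _ _ Gx Gy.
- by move=> [x x'] /= Gx; have := g4 _ Gx.
- by move=> [x x'] /= /g5 /= ->.
Qed.

Lemma piso_gal (G : piso) : exists s : gal S, forall x y, piso_set G (x, y) -> s x = y.
Proof.
have [H GH maxH] := piso_maximal G; have HP := pisoP H.
have fst_total x : exists y, piso_set H (x, y).
  by have [H' HH' [y H'y]] := piso_extend H x; exists y; apply: maxH H'y.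
have snd_total y : exists x, piso_set H (x, y).
  have [H' HH' [x H'x]] := piso_extend (Piso (iso_graph_swap H)) y.
  exists x; apply: (maxH (Piso (iso_graph_swap H'))) => //= -[a b] Hab.
  exact: HH'.
have fun_inj x y x' y' : piso_set H (x, y) -> piso_set H (x', y') -> (x == x') = (y == y').
  move=> Hx Hx'; have := graph_eq0 HP (graphB HP Hx Hx').
  by rewrite /= !subr_eq0.
pose f x := sval (cid (fst_total x)).
have fP x : piso_set H (x, f x) by rewrite /f; case: cid.
have fE x y : piso_set H (x, y) -> f x = y.
  by move=> Hxy; apply/eqP; rewrite -(fun_inj _ _ _ _ (fP x) Hxy).
have fZ : zmod_morphism f by move=> x y; apply: fE; have := graphB HP (fP x) (fP y).
have fM : monoid_morphism f.
  split=> [|x y]; apply: fE; last by have := graphM HP (fP x) (fP y).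
  by have := graph_base HP 1; rewrite rmorph1.
pose fz := GRing.isZmodMorphism.Build S S f fZ.
pose fm := GRing.isMonoidMorphism.Build S S f fM.
pose h : {rmorphism S -> S} := HB.pack f fz fm.
have hbij : bijective h.
  exists (fun y => sval (cid (snd_total y))) => y; case: cid => x /= Hx; last exact: fE.
  by apply/eqP; rewrite (fun_inj _ _ _ _ Hx (fP y)).
have hfix x : h (sc_inj S x) = sc_inj S x by apply: fE; apply: graph_base HP x.
by exists (Gal hbij hfix) => x y /GH /fE.
Qed.

Lemma gal_fixed_field (a : S) : (forall s : gal S, s a = a) -> exists x, sc_inj S x = a.
Proof.
move=> fix_a; have [|m [m0 mP sep_m]] := @separable_minpoly K (sc_inj S) a.
  by move=> x; exists x.
have ma : root (map_poly (sc_inj S) m) a by rewrite mP.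
have /factor_theorem[q mE] := ma.
have : separable_poly (map_poly (sc_inj S) m) by rewrite separable_map.
rewrite mE separable_root => /andP[sep_q qa].
have [/size_poly1P[c c0 qE]|q1] := boolP (size q == 1%N).
  exists (- (m`_0 / m`_1)); have coefE i : sc_inj S m`_i = (c%:P * ('X - a%:P))`_i.
    by rewrite -qE -mE coef_map.
  rewrite rmorphN fmorph_div !coefE !coefCM !coefB !coefX !coefC /=.
  by rewrite subr0 sub0r mulr1 mulrN mulNr opprK mulrC mulKf.
have [b qb] := sc_closed sep_q q1.
have mb : root (map_poly (sc_inj S) m) b by rewrite mE rootM qb.
have base x : exists l, sc_inj S l = sc_inj S x /\ sc_inj S l = sc_inj S x by exists x.
have [s sP] := piso_gal (Piso (iso_graph_adjoin base m0 mP mb)).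
have sab : s a = b by apply: sP; apply: adjoin_graphX.
by rewrite -(fix_a s) sab qb in qa.
Qed.

End PartialIso.

(** * Hilbert 90 for SL_2 *)

Section Hilbert90.
Variables (K : fieldType) (S : sep_closure K).
Implicit Types (s t : gal S) (X : seq S).

Definition id_gal : gal S.
Proof. by exists (GRing.RMorphism.clone _ _ (@idfun S) _); first by exists id. Defined.

Lemma gal_inv_ex s : exists t : gal S, cancel t s /\ cancel s t.
Proof.
have [f sK fK] := gal_bij s.
have fZ : zmod_morphism f by move=> x y; apply: (fmorph_inj s); rewrite rmorphB !fK.
have fM : monoid_morphism f.
  by split=> [|x y]; apply: (fmorph_inj s); rewrite !(fK, rmorph1, rmorphM).
pose fz := GRing.isZmodMorphism.Build S S f fZ.
pose fm := GRing.isMonoidMorphism.Build S S f fM.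
pose h : {rmorphism S -> S} := HB.pack f fz fm.
have hbij : bijective h by exists s.
have hfix x : h (sc_inj S x) = sc_inj S x by have := sK (sc_inj S x); rewrite gal_fix.
by exists (Gal hbij hfix).
Qed.

Lemma dedekind (T : eqType) (P : set S) (sigma : T -> {rmorphism S -> S})
    (a : T -> S) (l : seq T) :
  P 1 -> (forall x y, P x -> P y -> P (x * y)) -> uniq l ->
  {in l &, forall i j, i != j -> exists2 x, P x & sigma i x != sigma j x} ->
  (forall x, P x -> \sum_(i <- l) a i * sigma i x = 0) ->
  {in l, forall i, a i = 0}.
Proof.
move=> P1 PM; elim: l a => [|i0 l IHl] a //= /andP[i0l Ul] dist rel.
have a0 : {in l, forall i, a i = 0}.
  move=> i il; have i0i : i != i0 by apply: contraNneq i0l => <-.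
  have [||x Px xi] := dist i i0 _ _ i0i; rewrite ?inE ?il ?orbT ?eqxx //.
  suff /eqP : a i * (sigma i x - sigma i0 x) = 0.
    by rewrite mulf_eq0 subr_eq0 (negPf xi) orbF => /eqP.
  apply: (IHl (fun j => a j * (sigma j x - sigma i0 x)) Ul _ _ i il) => [j k jl kl|y Py].
    by apply: dist; rewrite inE ?jl ?kl orbT.
  have := rel (x * y) (PM _ _ Px Py); have := rel y Py.
  rewrite !big_cons => Ey Exy.
  transitivity (\sum_(j <- l) a j * sigma j (x * y) -
                sigma i0 x * \sum_(j <- l) a j * sigma j y).
    rewrite big_distrr -sumrB; apply: eq_bigr => j _ /=.
    by rewrite rmorphM mulrBr mulrBl !mulrA [sigma i0 x * _]mulrC.
  move/eqP: Ey; rewrite addrC addr_eq0 => /eqP ->.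
  move/eqP: Exy; rewrite addrC addr_eq0 => /eqP ->.
  by rewrite rmorphM mulrN opprK mulrCA addNr.
move=> i; rewrite inE => /orP[/eqP ->|]; last exact: a0.
have := rel 1 P1; rewrite big_cons rmorph1 mulr1 big1_seq ?addr0 // => j /andP[_ jl].
by rewrite a0 ?mul0r.
Qed.

Lemma root_seq (p : {poly S}) : p != 0 -> exists r : seq S, forall x, root p x -> x \in r.
Proof.
have [n] := ubnP (size p); elim: n p => // n IHn p szp p0.
have [[x px]|nroot] := pselect (exists x, root p x); last first.
  by exists [::] => x px; case: nroot; exists x.
have /factor_theorem[q qE] := px.
have q0 : q != 0 by apply: contraNneq p0 => q0; rewrite qE q0 mul0r.
have [||r rP] := IHn q; rewrite //.
  by move: szp; rewrite qE size_Mmonic ?monicXsubC // size_XsubC addn2.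
exists (x :: r) => y; rewrite qE rootM root_XsubC inE => /orP[/rP ->|->] //.
by rewrite orbT.
Qed.

Lemma gal_restrictions X : exists E : seq (seq S), uniq E /\
  forall r, (r \in E) <-> exists s, r = map s X.
Proof.
suff [E EP] : exists E : seq (seq S), forall s, map s X \in E.
  exists (undup [seq r <- E | `[< exists s, r = map s X >]]).
  split=> [|r]; first exact: undup_uniq.
  rewrite mem_undup mem_filter; split=> [/andP[/asboolP]//|[s ->]].
  by rewrite EP andbT; apply/asboolP; exists s.
elim: X => [|x X [E EP]]; first by exists [:: [::]] => s; rewrite inE.
have [p sep_p px] := sc_separable x.
have [|r rP] := @root_seq (map_poly (sc_inj S) p).
  by rewrite map_poly_eq0 separable_poly_neq0.
exists [seq y :: z | y <- r, z <- E] => s /=.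
apply: allpairs_f; last exact: EP.
apply: rP; rewrite -(eq_map_poly (gal_fix s)) map_poly_comp.
by rewrite (fmorph_root s).
Qed.

Section Descent.
Variables (C : gal S -> 'M[S]_2) (X : seq S).
Hypothesis C_det : forall s, \det (C s) = 1.
Hypothesis C_cocycle : forall s t, C (gal_mul s t) = C s *m map_mx s (C t).
Hypothesis C_cont : forall s t, {in X, s =1 t} -> C s = C t.

Let C_unit s : C s \in unitmx. Proof. by rewrite unitmxE C_det unitr1. Qed.

(* A multiplicative monoid containing X, so that embeddings with distinct
   restrictions to X are distinct characters of it. *)
Let P : set S := [set x | forall s t, {in X, s =1 t} -> s x = t x].

Let E : seq (seq S) := sval (cid (gal_restrictions X)).
Let E_uniq : uniq E. Proof. by have [] := svalP (cid (gal_restrictions X)). Qed.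
Let EP r : (r \in E) <-> exists s, r = map s X.
Proof. by have [] := svalP (cid (gal_restrictions X)). Qed.

Let rep (r : seq S) : gal S :=
  if pselect (exists s, r = map s X) is left h then sval (cid h) else id_gal.

Let repE r : r \in E -> map (rep r) X = r.
Proof. by move=> /EP; rewrite /rep; case: pselect => // h _; case: cid. Qed.

Let avg (w : 'rV[S]_2) : 'rV[S]_2 :=
  \sum_(r <- E) map_mx (rep r) w *m invmx (C (rep r)).

Let avg_gal s (w : 'rV[S]_2) : (forall i, P (w 0 i)) -> map_mx s (avg w) = avg w *m C s.
Proof.
move=> Pw; pose F r := map_mx (rep r) w *m invmx (C (rep r)).
have FE r : r \in E -> map_mx s (F r) = F (map s r) *m C s.
  move=> rE; have agree : {in X, rep (map s r) =1 gal_mul s (rep r)}.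
    apply/eq_in_map; rewrite repE.
      by rewrite -{1}(repE rE) -map_comp.
    by have /EP[t ->] := rE; apply/EP; exists (gal_mul s t); rewrite -map_comp.
  rewrite /F (C_cont agree) C_cocycle map_mxM /=.
  have -> : map_mx (rep (map s r)) w = map_mx s (map_mx (rep r) w).
    by apply/matrixP => i j; rewrite !mxE ord1 (Pw _ _ _ agree).
  have U : map_mx s (C (rep r)) \in unitmx by rewrite map_unitmx.
  rewrite map_invmx -!mulmxA; congr (_ *m _).
  set A := C s; set B := map_mx s _ in U *.
  have V : invmx (A *m B) *m A *m B = 1%:M by rewrite -mulmxA mulVmx // unitmx_mul C_unit.
  by rewrite -[RHS](mulmxK U) V mul1mx.
transitivity (\sum_(r <- E) F (map s r) *m C s).
  rewrite /avg raddf_sum /=; apply: eq_big_seq => r; exact: FE.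
rewrite -mulmx_suml; congr (_ *m _).
rewrite -(big_map (map s) xpredT F); apply: perm_big.
have [t [tK sK]] := gal_inv_ex s.
have inj : injective (map s) by apply/inj_map/fmorph_inj.
apply: uniq_perm; rewrite ?map_inj_uniq // => r.
apply/mapP/idP => [[r' /EP[u ->] ->]|/EP[u ->]].
  by apply/EP; exists (gal_mul s u); rewrite -map_comp.
exists (map (gal_mul t u) X); first by apply/EP; exists (gal_mul t u).
by rewrite -map_comp; apply: eq_map => x /=; rewrite tK.
Qed.

Let avg_nz (x : 'cV[S]_2) : x != 0 ->
  exists2 w : 'rV[S]_2, (forall i, P (w 0 i)) & avg w *m x != 0.
Proof.
move=> x0; apply: contrapT => avg0.
have {}avg0 (w : 'rV_2) : (forall i, P (w 0 i)) -> avg w *m x = 0.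
  by move=> Pw; apply/eqP; apply: contrapT => /negP h; apply: avg0; exists w.
have P1 : P 1 by move=> s t _; rewrite !rmorph1.
have PM y z : P y -> P z -> P (y * z).
  by move=> Py Pz s t st; rewrite !rmorphM (Py _ _ st) (Pz _ _ st).
have C0 i : {in E, forall r, (invmx (C (rep r)) *m x) i 0 = 0}.
  apply: (dedekind (P := P) (sigma := rep)) => //.
    move=> r r' rE r'E.
    have [/hasP[y yX rr'] _|/hasPn h] := boolP (has (fun y => rep r y != rep r' y) X).
      by exists y => // s t; apply.
    case/eqP; rewrite -(repE rE) -(repE r'E); apply/eq_in_map => y /h.
    by rewrite negbK => /eqP.
  move=> y Py; have := avg0 (\row_j (y *+ (j == i))).
  have Pi j : P ((\row_j (y *+ (j == i)) : 'rV_2) 0 j).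
    by rewrite mxE; case: (j == i) => //= s t _; rewrite !rmorph0.
  move=> /(_ Pi)/matrixP/(_ 0 0); rewrite mulmx_suml summxE [RHS]mxE => h; rewrite -[RHS]h.
  apply: eq_bigr => r _; rewrite -mulmxA [RHS]mxE (bigD1 i) //= big1 ?addr0.
    by rewrite !mxE eqxx mulr1n mulrC.
  by move=> j /negPf ji; rewrite !mxE ji mulr0n rmorph0 mul0r.
have EE : map id_gal X \in E by apply/EP; exists id_gal.
case/eqP: x0; rewrite -[x](mulKVmx (C_unit (rep (map id_gal X)))).
suff -> : invmx (C (rep (map id_gal X))) *m x = 0 by rewrite mulmx0.
by apply/matrixP => i j; rewrite ord1 C0 // mxE.
Qed.

Lemma hilbert90 : exists2 g : 'M[S]_2, \det g = 1 & forall s, map_mx s g = g *m C s.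
Proof.
have det2 (A : 'M[S]_2) : \det A = A 0 0 * A 1 1 - A 0 1 * A 1 0.
  by have [a [b [c [d ->]]]] := mx2P A; rewrite det_mx2 !mx2E.
have [|w1 Pw1 v10] := @avg_nz (delta_mx 0 0).
  by apply/eqP => /matrixP/(_ 0 0)/eqP; rewrite !mxE oner_eq0.
set v1 := avg w1 in v10.
pose x : 'cV[S]_2 := \col_i (if i == 0 then - v1 0 1 else v1 0 0).
have [|w2 Pw2 v2x] := @avg_nz x.
  apply: contraNneq v10 => /matrixP x0; apply/eqP/matrixP => i j.
  rewrite !ord1 mxE (bigD1 0) //= big1 => [|l /negPf l0]; last by rewrite [X in _ * X]mxE l0 mulr0.
  by have := x0 1 0; rewrite !mxE /= => ->; rewrite mul0r addr0.
set v2 := avg w2 in v2x.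
pose g0 : 'M[S]_2 := \matrix_(i, j) (if i == 0 then v1 0 j else v2 0 j).
have g0E s : map_mx s g0 = g0 *m C s.
  apply/matrixP => i j; rewrite !mxE.
  have := congr1 (fun A : 'rV_2 => A 0 j) (avg_gal s Pw1).
  have := congr1 (fun A : 'rV_2 => A 0 j) (avg_gal s Pw2).
  rewrite !mxE -/v1 -/v2 => E2 E1.
  case iE: (i == 0); rewrite ?E1 ?E2;
    by apply: eq_bigr => l _; rewrite mxE iE.
have det0 : \det g0 != 0.
  apply: contraNneq v2x; rewrite det2 !mxE /= => d0.
  apply/eqP/matrixP => i j; rewrite !ord1 !mxE !big_ord_recl big_ord0 !mxE /=.
  have -> : lift ord0 ord0 = 1 :> 'I_2 by exact/val_inj.
  by rewrite -[RHS]d0 addr0 mulrN addrC [v2 0 1 * _]mulrC [v2 0 0 * _]mulrC.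
have [d dE] : exists d, sc_inj S d = \det g0.
  by apply: gal_fixed_field => s; rewrite -det_map_mx g0E det_mulmx C_det mulr1.
pose D : 'M[S]_2 := \matrix_(i, j) (if i == j then if i == 0 then 1 else (sc_inj S d)^-1 else 0).
exists (D *m g0) => [|s].
  by rewrite det_mulmx det2 !mxE /= mul1r mul0r subr0 dE mulVf.
rewrite map_mxM g0E mulmxA; congr (_ *m _ *m _).
apply/matrixP => i j; rewrite !mxE; case: (i == j); last by rewrite rmorph0.
by case: (i == 0); rewrite ?rmorph1 // fmorphV gal_fix.
Qed.

End Descent.

End Hilbert90.

(** * Translation by kernel points *)

Lemma curve_padd (K : fieldType) (k : K) (P Q : point K) : (2 : K) != 0 ->
  curve k P -> curve k Q -> curve k (padd P Q).
Proof.
move=> n2; case: P Q => [|x1 y1] [|x2 y2] //= E1 E2.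
case: ifPn => //= PQ; set m := if _ then _ else _.
have y12 : x1 = x2 -> y1 = y2 /\ y1 != 0.
  move=> x12; move: PQ; rewrite x12 eqxx /= => yy.
  have : (y1 - y2) * (y1 + y2) == 0 by rewrite -subr_sqr E1 E2 x12 subrr.
  rewrite mulf_eq0 subr_eq0 addr_eq0 (negPf yy) orbF => /eqP y12; split=> //.
  by apply: contraNneq yy; rewrite -y12 => ->; rewrite oppr0.
have ym : y2 = y1 + m * (x2 - x1).
  have [/[dup] x12 /y12[-> _]|x12] := eqVneq x1 x2; first by rewrite x12; ring.
  by rewrite /m (negPf x12); field; rewrite subr_eq0 eq_sym.
have mE : m * (y1 + y2) = x1 ^+ 2 + x1 * x2 + x2 ^+ 2.
  have [/[dup] x12 /y12[<- y0]|x12] := eqVneq x1 x2.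
    by rewrite /m x12 eqxx; field; rewrite y0 n2.
  have d0 : x2 - x1 != 0 by rewrite subr_eq0 eq_sym.
  apply: (mulfI d0); apply: etrans (_ : y2 ^+ 2 - y1 ^+ 2 = _).
    by rewrite ym; ring.
  by rewrite E1 E2; ring.
have kE : k = y1 ^+ 2 - x1 ^+ 3 by rewrite E1; ring.
apply/eqP; rewrite -subr_eq0; set x3 := m ^+ 2 - x1 - x2.
apply/eqP; apply: etrans (_ : - (x1 - x3) * (m * (y1 + y2) - (x1 ^+ 2 + x1 * x2 + x2 ^+ 2)) = _).
  by rewrite kE ym /x3; clearbody m; ring.
by rewrite mE subrr mulr0.
Qed.

Ltac nonzero nz := repeat first
  [ done | by rewrite nz | rewrite oppr_eq0 | rewrite invr_eq0
  | apply: mulf_neq0 | apply: expf_neq0 | apply/andP; split ].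

Section Translation.
Variables (K : fieldType) (k : K).
Hypotheses (n2 : (2 : K) != 0) (n3 : (3 : K) != 0) (k0 : k != 0).
Local Notation A := (ker_phihat k).
Local Notation f0 := (form0 k).

Let nz := (oppr_eq0, oner_neq0 K, n2, n3, num23_neq0 n2 n3).

(* The curve z^3 = form0 k (x, y) as a model of E_{-27k}; on it x = 0 forces
   z = 0, and (0 : 1 : 0) is the point at infinity. *)
Definition cubic_point (x y z : K) : point K :=
  if x == 0 then Infty else Aff (3 * z / x) (9 * y / x).

Definition on_cubic (x y z : K) : Prop :=
  (x, y, z) != (0, 0, 0) /\ z ^+ 3 = cfeval f0 x y.

Lemma cfeval_form0 x y : cfeval f0 x y = x * (k * x ^+ 2 + 3 * y ^+ 2).
Proof. by rewrite /cfeval /=; ring. Qed.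

Lemma on_cubic_x0 y z : on_cubic 0 y z -> z = 0 /\ y != 0.
Proof.
move=> [nz0]; rewrite cfeval_form0 mul0r => /eqP; rewrite expf_eq0 /= => /eqP z0.
by split=> //; apply: contraNneq nz0 => ->; rewrite z0.
Qed.

Lemma cubic_point_curve x y z : on_cubic x y z -> curve (- (27 * k)) (cubic_point x y z).
Proof.
rewrite /cubic_point; have [//|x0] := eqVneq x 0.
move=> [_]; rewrite cfeval_form0 /= => zE.
have -> : (3 * z / x) ^+ 3 = 27 * z ^+ 3 / x ^+ 3 by field.
by rewrite zE; field.
Qed.

Lemma curve_cubic_point Q : curve (- (27 * k)) Q ->
  exists x y z, [/\ on_cubic x y z, cubic_point x y z = Q &
    (x, y, z) = if Q is Aff X Y then (1, Y / 9, X / 3) else (0, 1, 0)].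
Proof.
case: Q => [_|X Y /= YE].
  exists 0, 1, 0; rewrite /cubic_point eqxx; split=> //; split.
    by rewrite !xpair_eqE oner_eq0 andbF.
  by rewrite cfeval_form0 expr0n mul0r.
exists 1, (Y / 9), (X / 3); rewrite /cubic_point oner_eq0; split=> //; last first.
  by congr Aff; field; nonzero nz.
split; first by rewrite !xpair_eqE oner_eq0.
have XE : X ^+ 3 = Y ^+ 2 + 27 * k by rewrite YE; ring.
rewrite cfeval_form0; apply: etrans (_ : X ^+ 3 / 27 = _); first by field; nonzero nz.
by rewrite XE; field; nonzero nz.
Qed.

Lemma cubic_point_inj x1 y1 z1 x2 y2 z2 :
  on_cubic x1 y1 z1 -> on_cubic x2 y2 z2 ->
  cubic_point x1 y1 z1 = cubic_point x2 y2 z2 ->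
  exists l, [/\ x2 = l * x1, y2 = l * y1 & z2 = l * z1].
Proof.
rewrite /cubic_point; have [->|x10] := eqVneq x1 0.
  have [->|//] := eqVneq x2 0; move=> /on_cubic_x0[-> y1n] /on_cubic_x0[-> y2n] _.
  by exists (y2 / y1); rewrite !mulr0 mulfVK.
have [//|x20] := eqVneq x2 0 => _ _ [zE yE]; exists (x2 / x1); split.
- by rewrite mulfVK.
- have : 9 * y2 = 9 * (x2 / x1 * y1).
    by rewrite -[LHS](mulfVK x20) -yE; field.
  by apply: mulfI; rewrite nz.
- have : 3 * z2 = 3 * (x2 / x1 * z1).
    by rewrite -[LHS](mulfVK x20) -zE; field.
  exact: mulfI.
Qed.

Lemma phihat_cubic_point x y z : on_cubic x y z -> phihat k (cubic_point x y z) =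
  if z == 0 then Infty else
  Aff ((y ^+ 2 - k * x ^+ 2) / z ^+ 2) (y * (y ^+ 2 + 3 * k * x ^+ 2) / z ^+ 3).
Proof.
rewrite /cubic_point; have [-> /on_cubic_x0[-> _]|x0 [_ zE]] := eqVneq x 0; first by rewrite eqxx.
rewrite /= !mulf_eq0 invr_eq0 (negPf x0) orbF (negPf n3) /=.
have [//|z0] := eqVneq z 0.
rewrite cfeval_form0 in zE.
have kE : k = (z ^+ 3 - 3 * x * y ^+ 2) / x ^+ 3 by rewrite zE; field.
by rewrite kE; congr Aff; field; nonzero nz.
Qed.

Lemma phihat_curve Q : curve (- (27 * k)) Q -> curve k (phihat k Q).
Proof.
move=> /curve_cubic_point[x [y [z [on <- _]]]]; rewrite phihat_cubic_point //.
have [//|z0] := eqVneq z 0; case: on => _ /=; rewrite cfeval_form0 => zE.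
rewrite /=; apply: (mulIf (expf_neq0 6 z0)).
have -> : ((y ^+ 2 - k * x ^+ 2) / z ^+ 2) ^+ 3 + k =
  ((y ^+ 2 - k * x ^+ 2) ^+ 3 + k * (z ^+ 3) ^+ 2) / z ^+ 6 by field.
rewrite mulfVK ?expf_neq0 //.
have -> : (y * (y ^+ 2 + 3 * k * x ^+ 2) / z ^+ 3) ^+ 2 * z ^+ 6 =
  (y * (y ^+ 2 + 3 * k * x ^+ 2)) ^+ 2 by field.
by rewrite zE; ring.
Qed.

Lemma on_cubic_ker T x y z : A T -> on_cubic x y z ->
  on_cubic (x * ker_mx k T 0 0 + y * ker_mx k T 1 0)
           (x * ker_mx k T 0 1 + y * ker_mx k T 1 1) z.
Proof.
move=> AT [nz0 zE]; split; last by rewrite -cfeval_act ker_mx_act.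
apply: contraNneq nz0 => -[x0 y0 ->].
by have [-> ->] := row_mul_eq0 (ker_mx_det n2 n3 k0 AT) x0 y0.
Qed.

Lemma padd_cubic_point T x y z : A T -> on_cubic x y z ->
  padd (cubic_point x y z) T =
  cubic_point (x * ker_mx k T 0 0 + y * ker_mx k T 1 0)
              (x * ker_mx k T 0 1 + y * ker_mx k T 1 1) z.
Proof.
move=> /kerP[->|[e eE ->]] on.
  by rewrite /= mx2_1 !mx2E !mulr0 !mulr1 add0r addr0; case: cubic_point.
have e0 := ker_aff_neq0 n3 k0 eE; have kE := ker_const n2 n3 eE.
rewrite /ker_mx !mx2E.
have -> : x * - 2^-1 + y * (e / (2 * 3 * k)) = - (e * x + 9 * y) / (2 * e).
  by rewrite kE; field; nonzero nz.
have -> : x * (e / (2 * 3)) + y * - 2^-1 = (e * x - 3 * y) / 6 by field; nonzero nz.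
rewrite /cubic_point; have [x0|x0] := eqVneq x 0.
  rewrite x0 in on *; have [-> y0] := on_cubic_x0 on.
  rewrite mulr0 add0r sub0r ifF; last first.
    by apply/negbTE; nonzero nz.
  by congr Aff; field; nonzero nz.
case: on => _; rewrite cfeval_form0 => zE.
have {}zE : 27 * z ^+ 3 = - (x * ((e * x - 9 * y) * (e * x + 9 * y))).
  by rewrite zE kE; field; nonzero nz.
have [z0|z0] := eqVneq z 0.
  have : (e * x - 9 * y) * (e * x + 9 * y) == 0.
    rewrite z0 expr0n mulr0 in zE; move/esym/eqP: zE.
    by rewrite oppr_eq0 mulf_eq0 (negPf x0).
  rewrite z0 mulr0 mul0r mulf_eq0 subr_eq0 addr_eq0 => /orP[]/eqP h.
    have -> : 9 * y / x = e by rewrite -h mulfK.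
    rewrite (ker_add_self n2 n3 k0 eE) -h; have -> : e * x + e * x = 2 * (e * x) by ring.
    rewrite ifF; last by apply/negbTE; nonzero nz.
    have yE : y = e * x / 9 by rewrite h; field; nonzero nz.
    by congr Aff; rewrite ?mulr0 ?mul0r // yE; field; nonzero nz.
  have -> : 9 * y / x = - e by rewrite -[9 * y]opprK -h mulNr mulfK.
  by rewrite h addNr oppr0 !mul0r !eqxx /= !eqxx.
(* The curve equation is 27 z^3 = - x p q: x, y and e are rational functions of
   the independent variables p, q and z. *)
set p := e * x - 9 * y in zE; set q := e * x + 9 * y in zE *.
have pq0 : x * (p * q) != 0.
  by rewrite -oppr_eq0 -zE mulf_neq0 ?nz ?expf_neq0.
have [p0 q0] : p != 0 /\ q != 0.
  by move: pq0; rewrite !mulf_eq0 !negb_or => /and3P[].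
have pqe : p + q = 2 * e * x by rewrite /p /q; ring.
have s0 : p + q != 0 by rewrite pqe !mulf_neq0.
have xE : x = - (27 * z ^+ 3) / (p * q).
  by rewrite zE opprK mulfK // mulf_neq0.
have yE : y = (q - p) / 18 by rewrite /p /q; field; nonzero nz.
have epq : e = - ((p + q) * (p * q)) / (54 * z ^+ 3).
  apply: (mulIf x0); apply: (mulfI n2); rewrite mulrA -pqe [in RHS]xE.
  by field; nonzero nz.
have X0 : 3 * z / x != 0 by rewrite !mulf_neq0 ?invr_eq0.
rewrite /= (negPf X0) /= ifF; last first.
  by apply/negbTE; nonzero nz.
clearbody p q; rewrite yE xE epq; congr Aff; field; nonzero nz.
Qed.

Lemma phihat_translate T x y z : A T -> on_cubic x y z ->
  phihat k (cubic_point (x * ker_mx k T 0 0 + y * ker_mx k T 1 0)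
              (x * ker_mx k T 0 1 + y * ker_mx k T 1 1) z) = phihat k (cubic_point x y z).
Proof.
move=> AT on; rewrite !phihat_cubic_point //; last exact: on_cubic_ker.
have [//|z0] := eqVneq z 0; move/kerP: AT => [->|[e eE ->]].
  by rewrite /= mx2_1 !mx2E !mulr0 !mulr1 add0r addr0.
have e0 := ker_aff_neq0 n3 k0 eE; have kE := ker_const n2 n3 eE.
by rewrite /ker_mx !mx2E kE; congr Aff; field; nonzero nz.
Qed.

Lemma ker_mxC P Q : A P -> A Q -> ker_mx k P *m ker_mx k Q = ker_mx k Q *m ker_mx k P.
Proof.
move=> /kerP[->|[e _ ->]] /kerP[->|[e' _ ->]]; rewrite /= ?mulmx1 ?mul1mx // !mx2M.
by congr mx2; field; nonzero nz.
Qed.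

Lemma ker_x0 y : curve (- (27 * k)) (Aff 0 y) -> A (Aff 0 y).
Proof. by split=> //=; rewrite eqxx. Qed.

Lemma ker_psub P Q D : A P -> A Q -> A D -> psub P Q = D <-> P = padd Q D.
Proof.
move=> AP AQ AD; have AQ' := ker_opp AQ.
have [AE ME] := ker_mx_mul n2 n3 k0 AP AQ'.
have [AF MF] := ker_mx_mul n2 n3 k0 AQ AD.
have mQ := ker_mxN n2 n3 k0 AQ; have mQ' := mulmx1C mQ.
split=> E; apply: (@ker_mx_inj _ k n2 n3) => //.
  by rewrite MF -E ME (ker_mxC AP AQ') mulmxA mQ' mul1mx.
by rewrite /psub ME E MF (ker_mxC AQ AD) -mulmxA mQ' mulmx1.
Qed.

Lemma psub_padd Q T : curve (- (27 * k)) Q -> A T -> psub (padd Q T) Q = T.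
Proof.
case: Q => [_ AT|X Y QE AT]; first by rewrite /psub /=; case: (T).
have [X0|X0] := eqVneq X 0.
  rewrite X0 in QE *; have AQ := ker_x0 QE.
  have [AF _] := ker_mx_mul n2 n3 k0 AQ AT; exact/(ker_psub AF AQ AT).
move/kerP: AT => [->|[e eE ->]]; first by rewrite /psub padd_opp.
rewrite /psub /= (negPf X0) /=; set m := (e - Y) / (0 - X).
have eY : e = Y - m * X by rewrite /m sub0r; field; nonzero nz.
set x3 := m ^+ 2 - X - 0; set y3 := m * (X - x3) - Y.
have [x3X|x3X] := eqVneq x3 X; last first.
  have -> : (- Y - y3) / (X - x3) = - m.
    by rewrite /y3; field; rewrite subr_eq0 eq_sym.
  by rewrite eY /y3 /x3; congr Aff; ring.
have m2 : m ^+ 2 = 2 * X.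
  have -> : m ^+ 2 = x3 + X by rewrite /x3; ring.
  by rewrite x3X; ring.
have y3E : y3 = - Y by rewrite /y3 x3X subrr mulr0 sub0r.
have mY : 2 * Y * m = 3 * X ^+ 2.
  apply: (mulIf X0); apply: etrans (_ : Y ^+ 2 - e ^+ 2 + m ^+ 2 * X ^+ 2 = _).
    by rewrite eY; ring.
  by rewrite QE eE m2; ring.
have Y0 : Y != 0.
  apply: contraNneq X0 => Y0; have : 3 * X ^+ 2 == 0 by rewrite -mY Y0 mulr0 mul0r.
  by rewrite mulf_eq0 (negPf n3) expf_eq0.
rewrite y3E opprK [- Y == Y]eq_sym (neq_opp n2 Y0) x3X.
have -> : 3 * X ^+ 2 / (2 * - Y) = - m by rewrite -mY; field; nonzero nz.
by rewrite sqrrN m2 eY; congr Aff; ring.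
Qed.

Lemma psub_ker P Q : curve (- (27 * k)) P -> curve (- (27 * k)) Q -> A (psub P Q) ->
  P = padd Q (psub P Q).
Proof.
move=> PE QE AD.
have [AQ|nAQ] := pselect (A Q).
  have [AP|nAP] := pselect (A P); first exact/(ker_psub AP AQ AD).
  exfalso; case/kerP: AQ AD => [->|[y2 y2E ->]].
    by rewrite /psub; case: (P) nAP.
  case: P PE nAP => [_ []//|x1 y1 PE nAP] AD.
  have [x10|x10] := eqVneq x1 0; first by apply: nAP; rewrite x10 in PE *; apply: ker_x0.
  move: AD; rewrite /psub /= (negPf x10) /= => /kerP[//|[e _ [+ _]]].
  rewrite subr0 => /eqP; rewrite subr_eq0 => /eqP h; have y20 := ker_aff_neq0 n3 k0 y2E.
  have h1 : (y1 + y2) ^+ 2 = x1 ^+ 3.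
    by rewrite [RHS]exprSr -[X in _ = _ * X]h; field; nonzero nz.
  have : 2 * y2 * (y1 + y2) == 0.
    apply/eqP; apply: etrans (_ : (y1 + y2) ^+ 2 - y1 ^+ 2 + y2 ^+ 2 = _); first by ring.
    by rewrite h1 y2E; move: PE => /= ->; ring.
  rewrite !mulf_eq0 (negPf n2) (negPf y20) /= => /eqP y12.
  by move/esym/eqP: h1; rewrite y12 expr0n expf_eq0 (negPf x10).
case: Q QE nAQ AD => [_ []//|x2 y2 QE nAQ].
have x20 : x2 != 0 by apply: contra_notN nAQ => /eqP x20; rewrite x20 in QE *; apply: ker_x0.
case: P PE => [_ /ker_opp|x1 y1 PE]; first by rewrite /= opprK.
rewrite /psub /= opprK; case: ifPn => [/andP[/eqP -> /eqP ->] //|PQ].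
set m := if _ then _ else _ => /kerP[//|[e _ [h _]]].
rewrite h subr0.
have ym : y2 = - (y1 + m * (x2 - x1)).
  rewrite /m; case: eqVneq PQ => [x12 /= y12|x12 _]; last by field; rewrite subr_eq0 eq_sym.
  have : (y1 - y2) * (y1 + y2) == 0.
    by apply/eqP; rewrite -subr_sqr (PE : y1 ^+ 2 = _) (QE : y2 ^+ 2 = _) x12 subrr.
  rewrite mulf_eq0 subr_eq0 (negPf y12) addr_eq0 /= => /eqP ->.
  by rewrite x12 subrr mulr0 addr0 opprK.
rewrite (negPf x20) /=.
(* P, -Q and -(P - Q) are collinear, so the line through Q and P - Q has the
   opposite slope. *)
have -> : (m * x1 - y1 - y2) / (0 - x2) = - m by rewrite ym; clearbody m; field; nonzero nz.
move/eqP: h; rewrite -addrA -opprD subr_eq0 sqrrN => /eqP ->.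
by congr Aff; rewrite ?ym; clearbody m; ring.
Qed.

End Translation.

(** * Cocycles attached to forms *)

Section Twist.
Variables (K : fieldType) (S : sep_closure K) (k : K).
Hypotheses (n2 : (2 : K) != 0) (n3 : (3 : K) != 0) (k0 : k != 0).
Local Notation iota := (sc_inj S).
Local Notation kS := (sc_inj S k).
Local Notation A := (ker_phihat kS).
Local Notation M := (ker_mx kS).
Implicit Types (s t : gal S) (c : cochain S) (f : cform K) (g : 'M[S]_2).

Let m2 : (2 : S) != 0. Proof. by rewrite -(rmorph_nat iota) fmorph_eq0. Qed.
Let m3 : (3 : S) != 0. Proof. by rewrite -(rmorph_nat iota) fmorph_eq0. Qed.
Let kS0 : kS != 0. Proof. by rewrite fmorph_eq0. Qed.

Lemma ker_gal s P : A P -> A (point_map s P).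
Proof. by move=> AP; have /(ker_phihat_map s) := AP; rewrite gal_fix. Qed.

Lemma ker_mx_gal s P : M (point_map s P) = map_mx s (M P).
Proof. by rewrite -ker_mx_map gal_fix. Qed.

Lemma form0_map : cform_map iota (form0 k) = form0 kS.
Proof. by rewrite /form0 cform_mapE rmorph0 rmorph1. Qed.

Lemma form0_gal s : cform_map s (form0 kS) = form0 kS.
Proof. by rewrite /form0 cform_mapE rmorph0 rmorph1 gal_fix. Qed.

Lemma cform_map_gal s f : cform_map s (cform_map iota f) = cform_map iota f.
Proof. by case: f => a b c d; rewrite !cform_mapE !gal_fix. Qed.

Lemma cform_map_inj (L L' : fieldType) (h : {rmorphism L -> L'}) : injective (cform_map h).
Proof.
move=> [a b c d] [a' b' c' d']; rewrite !cform_mapE.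
by move=> -[/fmorph_inj -> /fmorph_inj -> /fmorph_inj -> /fmorph_inj ->].
Qed.

Lemma map_mx2_inj (L L' : fieldType) (h : {rmorphism L -> L'}) :
  injective (fun g : 'M[L]_2 => map_mx h g).
Proof.
by move=> g g' /matrixP E; apply/matrixP => i j; have := E i j; rewrite !mxE => /fmorph_inj.
Qed.

Lemma gal_fixed_mx g : (forall s, map_mx s g = g) -> exists h, map_mx iota h = g.
Proof.
move=> fg; have ex i j : exists x, iota x = g i j.
  by apply: gal_fixed_field => s; have /matrixP/(_ i j) := fg s; rewrite mxE.
exists (\matrix_(i, j) sval (cid (ex i j))).
by apply/matrixP => i j; rewrite !mxE; case: cid.
Qed.

Lemma gal_fixed_form (f : cform S) : (forall s, cform_map s f = f) ->
  exists f', cform_map iota f' = f.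
Proof.
case: f => a b c d fix_f.
have [|a' aE] := @gal_fixed_field _ S a; first by move=> s; have [] := fix_f s.
have [|b' bE] := @gal_fixed_field _ S b; first by move=> s; have [] := fix_f s.
have [|c' cE] := @gal_fixed_field _ S c; first by move=> s; have [] := fix_f s.
have [|d' dE] := @gal_fixed_field _ S d; first by move=> s; have [] := fix_f s.
by exists (CForm a' b' c' d'); rewrite cform_mapE aE bE cE dE.
Qed.

(* [c] is the cocycle s |-> g^-1 s(g) of an element g of SL_2(S) carrying
   [form0 k] to [f], the kernel being embedded in SL_2(S) by [ker_mx]. *)
Definition twist f c : Prop :=
  (forall s, A (c s)) /\
  exists g, [/\ \det g = 1, cfact g (form0 kS) = cform_map iota f &
    forall s, map_mx s g = g *m M (c s)].

Let unit_det1 g : \det g = 1 -> g \in unitmx.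
Proof. by move=> g1; rewrite unitmxE g1 unitr1. Qed.

Let mul_det1I g (h h' : 'M[S]_2) : \det g = 1 -> g *m h = g *m h' -> h = h'.
Proof. by move=> /unit_det1 ug /(congr1 (mulmx (invmx g))); rewrite !mulKmx. Qed.

Lemma twist_cocycle f c : twist f c -> cocycle A c.
Proof.
move=> [Ac [g [g1 gf gc]]]; split=> // [s|s t].
  exists [:: g 0 0; g 0 1; g 1 0; g 1 1] => t ts.
  apply: (@ker_mx_inj _ _ m2 m3) => //; apply: (mul_det1I g1); rewrite -!gc.
  have [a [b [e [d gE]]]] := mx2P g; rewrite gE !mx2E in ts *.
  by rewrite !map_mx2 !ts // !inE eqxx ?orbT.
have [AE ME] := ker_mx_mul m2 m3 kS0 (Ac s) (ker_gal s (Ac t)).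
apply: (@ker_mx_inj _ _ m2 m3) => //; apply: (mul_det1I g1); rewrite -gc ME ker_mx_gal.
rewrite mulmxA -gc -map_mxM -gc.
by apply/matrixP => i j; rewrite !mxE.
Qed.

Lemma twist_exists f : cfdisc f = 4 * k -> exists c, twist f c.
Proof.
move=> df; have [|g g1 gf] := @sep_form0_orbit _ S kS (cform_map iota f) m2 m3 kS0.
  by rewrite cfdisc_map df rmorphM rmorph_nat.
have ug := unit_det1 g1.
have ex s : exists P, A P /\ invmx g *m map_mx s g = M P.
  have [||P AP PE] := @stab_form0 _ kS m2 m3 kS0 (invmx g *m map_mx s g).
  - by rewrite det_mulmx det_inv det_map_mx g1 rmorph1 invr1 mulr1.
  - rewrite cfactM -{1}(form0_gal s) -cform_map_act gf cform_map_gal -gf.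
    by rewrite -cfactM mulVmx // cfact1.
  by exists P.
exists (fun s => sval (cid (ex s))); split=> [s|]; first by case: cid => P [].
by exists g; split=> // s; case: cid => P /= [_ <-]; rewrite mulKVmx.
Qed.

Lemma cocycle_unit c s : cocycle A c -> (forall x, s x = x) -> c s = Infty.
Proof.
move=> [Ac cont coc] s1; have [X cX] := cont s.
have ss : c (gal_mul s s) = c s by apply: cX => x _ /=; rewrite !s1.
have sc : point_map s (c s) = c s by case: (c s) => //= x y; rewrite !s1.
have [AE ME] := ker_mx_mul m2 m3 kS0 (Ac s) (Ac s).
apply: (@ker_mx_inj _ kS m2 m3) => //.
apply: (mul_det1I (ker_mx_det m2 m3 kS0 (Ac s))).
by rewrite -ME -{2}sc -coc ss mulmx1.
Qed.

Lemma cocycle_uniform c : cocycle A c ->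
  exists X : seq S, forall s t, {in X, s =1 t} -> c s = c t.
Proof.
move=> cc; have [Ac cont coc] := cc; have [X cX] := cont (id_gal S).
exists X => s t st; have [s' [sK s'K]] := gal_inv_ex s.
have [Y cY] := cont t.
have c1 : c (gal_mul s' t) = Infty.
  rewrite -(cocycle_unit cc (s := id_gal S)) //; apply: cX => x xX /=.
  by rewrite -st // s'K.
rewrite -[RHS](cY (gal_mul s (gal_mul s' t))) => [|x _ /=]; last by rewrite sK.
by rewrite coc c1 /=; case: (c s).
Qed.

Lemma twist_surj c : cocycle A c -> exists2 f, cfdisc f = 4 * k & twist f c.
Proof.
move=> cc; have [X cX] := cocycle_uniform cc; have [Ac _ coc] := cc.
have [|||g g1 gc] := @hilbert90 K S (fun s => M (c s)) X.
- by move=> s; apply: ker_mx_det.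
- move=> s t; rewrite coc -ker_mx_gal.
  by have [_ ->] := ker_mx_mul m2 m3 kS0 (Ac s) (ker_gal s (Ac t)).
- by move=> s t /cX ->.
have [|f fE] := @gal_fixed_form (cfact g (form0 kS)).
  by move=> s; rewrite cform_map_act form0_gal gc cfactM ker_mx_act.
exists f; last by split=> //; exists g.
apply: (fmorph_inj iota); rewrite -cfdisc_map fE cfdisc_act // cfdisc_form0.
by rewrite rmorphM rmorph_nat.
Qed.

Let ker_sub s m : A m -> A (psub (point_map s m) m) /\
  M (psub (point_map s m) m) = map_mx s (M m) *m M (popp m).
Proof.
by move=> Am; rewrite -ker_mx_gal; apply: ker_mx_mul => //; [apply: ker_gal|apply: ker_opp].
Qed.

Lemma twist_cohomologous f c c' : twist f c -> cocycle A c' ->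
  cohomologous A c c' -> twist f c'.
Proof.
move=> [Ac [g [g1 gf gc]]] [Ac' _ _] [m Am cm]; split=> //.
exists (g *m M m); split=> [||s].
- by rewrite det_mulmx g1 mul1r ker_mx_det.
- by rewrite cfactM ker_mx_act.
have [Asm Msm] := ker_sub s Am; have [_ Mc'] := ker_mx_mul m2 m3 kS0 (Ac s) Asm.
have As := ker_gal s Am; have Ao := ker_opp Am.
rewrite map_mxM gc cm Mc' Msm -!mulmxA; congr (_ *m _).
rewrite -ker_mx_gal [RHS]mulmxA (ker_mxC m2 m3 kS0 Am (Ac s)) -mulmxA; congr (_ *m _).
rewrite mulmxA (ker_mxC m2 m3 kS0 Am As) -mulmxA.
by rewrite (ker_mxC m2 m3 kS0 Am Ao) ker_mxN // mulmx1.
Qed.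

Lemma twist_unique f c c' : twist f c -> twist f c' -> cohomologous A c c'.
Proof.
move=> [Ac [g [g1 gf gc]]] [Ac' [g' [g1' gf' gc']]].
have [||m Am mE] := @stab_form0 _ kS m2 m3 kS0 (invmx g *m g').
- by rewrite det_mulmx det_inv g1 g1' invr1 mulr1.
- by rewrite cfactM gf' -gf -cfactM mulVmx ?cfact1 // unit_det1.
have {}mE : g' = g *m M m by rewrite -mE mulKVmx // unit_det1.
exists m => // s; have [Asm Msm] := ker_sub s Am.
have [A' Mc'] := ker_mx_mul m2 m3 kS0 (Ac s) Asm.
apply: (@ker_mx_inj _ kS m2 m3) => //; rewrite Mc' Msm.
have As := ker_gal s Am; have Ao := ker_opp Am.
apply: (mul_det1I g1'); rewrite -gc' mE map_mxM gc -!mulmxA; congr (_ *m _).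
rewrite -ker_mx_gal [RHS]mulmxA (ker_mxC m2 m3 kS0 Am (Ac s)) -mulmxA; congr (_ *m _).
rewrite mulmxA (ker_mxC m2 m3 kS0 Am As) -mulmxA.
by rewrite (ker_mxC m2 m3 kS0 Am Ao) ker_mxN // mulmx1.
Qed.

Lemma twist_class f c : twist f c -> h1_class A c = [set c' | twist f c'].
Proof.
move=> fc; apply/seteqP; split=> c' /= => [[? ?]|fc']; first exact: twist_cohomologous fc _ _.
by split; [apply: twist_cocycle fc'|apply: twist_unique fc fc'].
Qed.

Lemma twist_orbit f c (h : 'M[K]_2) : \det h = 1 -> twist f c -> twist (cfact h f) c.
Proof.
move=> h1 [Ac [g [g1 gf gc]]]; split=> //; exists (map_mx iota h *m g); split=> [||s].
- by rewrite det_mulmx det_map_mx h1 rmorph1 mul1r.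
- by rewrite cfactM gf cform_map_act.
rewrite map_mxM gc mulmxA; congr (_ *m _ *m _).
by apply/matrixP => i j; rewrite !mxE gal_fix.
Qed.

Lemma twist_inj f f' c : twist f c -> twist f' c ->
  exists2 h : 'M[K]_2, \det h = 1 & cfact h f = f'.
Proof.
move=> [Ac [g [g1 gf gc]]] [_ [g' [g1' gf' gc']]].
have [|h hE] := @gal_fixed_mx (g' *m invmx g).
  move=> s; rewrite map_mxM map_invmx gc gc'.
  have := unit_det1 (ker_mx_det m2 m3 kS0 (Ac s)); set C := M (c s) => uC.
  have ug := unit_det1 g1; have ug' := unit_det1 g1'.
  have ugC : g *m C \in unitmx by rewrite unitmx_mul ug.
  have -> : invmx (g *m C) = invmx C *m invmx g.
    by rewrite -[RHS](mulmxK ugC) mulmxA mulmxKV // mulVmx // mul1mx.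
  by rewrite mulmxA mulmxK.
exists h.
  apply: (fmorph_inj iota); rewrite -det_map_mx hE det_mulmx det_inv g1 g1' invr1 mulr1.
  by rewrite rmorph1.
apply: (cform_map_inj (h := iota)); rewrite cform_map_act hE -gf -gf' -cfactM.
by rewrite mulmxKV // unit_det1.
Qed.

Lemma twist_connecting f c x y z : twist f c -> (x, y, z) != (0, 0, 0) ->
  z ^+ 3 = cfeval f x y -> connecting_image S k (h1_class A c).
Proof.
move=> [Ac [g [g1 gf gc]]] nz0 zE.
pose x' := iota x * g 0 0 + iota y * g 1 0; pose y' := iota x * g 0 1 + iota y * g 1 1.
have on : on_cubic kS x' y' (iota z).
  split; last first.
    by rewrite /x' /y' -cfeval_act gf -rmorphXn zE cfeval_map.
  apply: contraNneq nz0 => -[x0 y0 /eqP]; rewrite fmorph_eq0 => /eqP ->.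
  have [/eqP + /eqP +] := row_mul_eq0 g1 x0 y0.
  by rewrite !fmorph_eq0 => /eqP -> /eqP ->.
pose Q := cubic_point x' y' (iota z).
have QE := cubic_point_curve on.
have sQ s : point_map s Q = padd Q (c s).
  rewrite (padd_cubic_point m2 m3 kS0 (Ac s) on).
  have /matrixP sg := gc s; have := (sg 0 0, sg 0 1, sg 1 0, sg 1 1).
  rewrite !mxE !big_ord_recl !big_ord0.
  have -> : lift ord0 ord0 = 1 :> 'I_2 by exact/val_inj.
  rewrite !addr0 => -[[[s00 s01] s10] s11].
  rewrite /Q /cubic_point -(fmorph_eq0 s).
  have sx : s x' = x' * M (c s) 0 0 + y' * M (c s) 1 0.
    by rewrite /x' /y' rmorphD !rmorphM !gal_fix s00 s10; ring.
  have sy : s y' = x' * M (c s) 0 1 + y' * M (c s) 1 1.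
    by rewrite /x' /y' rmorphD !rmorphM !gal_fix s01 s11; ring.
  rewrite -sx -sy; case: ifP => //= _.
  by rewrite !(rmorph_nat, fmorphV, rmorphM) gal_fix.
have phiQ s : point_map s (phihat kS Q) = phihat kS Q.
  have := phihat_map s kS Q; rewrite gal_fix => <-; rewrite sQ.
  by rewrite (padd_cubic_point m2 m3 kS0 (Ac s) on) phihat_translate.
have [P PE] : exists P, point_map iota P = phihat kS Q.
  case: (phihat kS Q) phiQ => [|X Y] XY; first by exists Infty.
  have [|X' XE] := @gal_fixed_field _ S X; first by move=> s; have [] := XY s.
  have [|Y' YE] := @gal_fixed_field _ S Y; first by move=> s; have [] := XY s.
  by exists (Aff X' Y'); rewrite /= XE YE.
exists P, Q; split=> //.
  by apply/(curve_map iota); rewrite PE; apply: phihat_curve.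
congr (h1_class A _); apply: funext => s.
by rewrite sQ (psub_padd m2 m3 kS0 QE (Ac s)).
Qed.

Lemma connecting_twist f c : twist f c -> connecting_image S k (h1_class A c) ->
  exists x y z, (x, y, z) != (0, 0, 0) /\ z ^+ 3 = cfeval f x y.
Proof.
move=> fc [P [Q [PE QE PQ cE]]]; have cc := twist_cocycle fc.
have Qs s : curve (- (27 * kS)) (point_map s Q).
  have : curve (s (- (27 * kS))) (point_map s Q) by apply/curve_map.
  by rewrite rmorphN rmorphM rmorph_nat gal_fix.
have [m Am cm] : cohomologous A (fun s => psub (point_map s Q) Q) c.
  have : h1_class A c c by rewrite (twist_class fc).
  by rewrite cE => -[].
have curve_opp (R : point S) : curve (- (27 * kS)) R -> curve (- (27 * kS)) (popp R).
  by case: R => //= X Y; rewrite sqrrN.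
have Ac s : A (c s) by case: cc.
have Ad s : A (psub (point_map s Q) Q).
  have := cm s; have [] := ker_sub s Am; set a := psub _ m; set D := psub _ Q => Aa _ E.
  have [x [y [z [on DE _]]]] : exists x y z, [/\ on_cubic kS x y z, cubic_point x y z = D &
    (x, y, z) = if D is Aff X Y then (1, Y / 9, X / 3) else (0, 1, 0)].
    by apply: curve_cubic_point => //; apply: curve_padd => //; apply: curve_opp.
  have on' := on_cubic_ker m2 m3 kS0 Aa on.
  suff <- : padd (c s) (popp a) = D by apply: (ker_mx_mul m2 m3 kS0 (Ac s) (ker_opp Aa)).1.
  rewrite E -DE (padd_cubic_point m2 m3 kS0 Aa on).
  rewrite (padd_cubic_point m2 m3 kS0 (ker_opp Aa) on').
  have := mulmx1C (ker_mxN m2 m3 kS0 Aa).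
  have [p [q [r [t ->]]]] := mx2P (M a); have [p' [q' [r' [t' ->]]]] := mx2P (M (popp a)).
  rewrite mx2M mx2_1 !mx2E => /mx2_inj[E1 E2 E3 E4].
  congr cubic_point.
    apply: etrans (_ : x * (p * p' + q * r') + y * (r * p' + t * r') = _); first by ring.
    by rewrite E1 E3 mulr1 mulr0 addr0.
  apply: etrans (_ : x * (p * q' + q * t') + y * (r * q' + t * t') = _); first by ring.
  by rewrite E2 E4 mulr1 mulr0 add0r.
have sQ s : point_map s Q = padd Q (psub (point_map s Q) Q).
  exact: (psub_ker m2 m3 kS0 (Qs s) QE (Ad s)).
have [_ [g [g1 gf gc]]] := fc; have Am' := ker_opp Am.
pose g' := g *m M (popp m); pose h := invmx g'.
have g1' : \det g' = 1 by rewrite det_mulmx g1 mul1r ker_mx_det.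
have gf' : cfact g' (form0 kS) = cform_map iota f by rewrite cfactM ker_mx_act.
have gc' s : map_mx s g' = g' *m M (psub (point_map s Q) Q).
  have [Asm Msm] := ker_sub s Am; have [_ Mc] := ker_mx_mul m2 m3 kS0 (Ad s) Asm.
  have As := ker_gal s Am; have Asm' := ker_gal s Am'.
  rewrite /g' map_mxM gc cm Mc Msm -!ker_mx_gal -!mulmxA; congr (_ *m _).
  rewrite (ker_mxC m2 m3 kS0 Am' (Ad s)); congr (_ *m _).
  rewrite (ker_mxC m2 m3 kS0 Am' Asm') mulmxA -[RHS]mul1mx; congr (_ *m _).
  by rewrite point_mapN; apply/mulmx1C/ker_mxN => //; apply: ker_gal.
have u' := unit_det1 g1'; have hg : h *m g' = 1%:M by rewrite mulVmx.
have h1 : \det h = 1 by rewrite det_inv g1' invr1.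
have [x [y [z [on xyzQ _]]]] := curve_cubic_point m2 m3 QE.
pose x1 := x * h 0 0 + y * h 1 0; pose y1 := x * h 0 1 + y * h 1 1.
have [nz0 zE] := on.
have fz : z ^+ 3 = cfeval (cform_map iota f) x1 y1.
  by rewrite -gf' /x1 /y1 -cfeval_act -cfactM hg cfact1.
have x1y1 : mx2 x y 0 0 *m h = mx2 x1 y1 0 0.
  have [p [q [r [t hE]]]] := mx2P h.
  by rewrite /x1 /y1 hE mx2M !mx2E !mul0r addr0.
have sxyz s : exists l, [/\ s x1 = l * x1, s y1 = l * y1 & s z = l * z].
  have [a [b [e [d ME]]]] := mx2P (M (psub (point_map s Q) Q)).
  have on' := on_cubic_ker m2 m3 kS0 (Ad s) on.
  have on'' : on_cubic kS (s x) (s y) (s z).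
    split; last by rewrite -rmorphXn zE cfeval_map form0_gal.
    apply: contraNneq nz0 => -[/eqP + /eqP + /eqP]; rewrite !fmorph_eq0.
    by move=> /eqP -> /eqP -> /eqP ->.
  have [|l [sx sy sz]] := cubic_point_inj m2 m3 on' on''.
    rewrite -(padd_cubic_point m2 m3 kS0 (Ad s) on) xyzQ -sQ -xyzQ.
    rewrite /cubic_point fmorph_eq0; case: ifP => //= _.
    by rewrite !(rmorph_nat, fmorphV, rmorphM).
  have : map_mx s (mx2 x1 y1 0 0) = l *: mx2 x1 y1 0 0.
    rewrite -x1y1 map_mxM map_mx2 sx sy rmorph0 /h map_invmx gc' ME !mx2E -/h.
    have -> : mx2 (l * (x * a + y * e)) (l * (x * b + y * d)) 0 0 =
        l *: (mx2 x y 0 0 *m h *m (g' *m mx2 a b e d)).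
      rewrite mulmxA mulmxKV // mx2M !mul0r addr0.
      by apply/matrixP => i j; rewrite !mxE; case: (i == 0); case: (j == 0); rewrite ?mulr0.
    rewrite -scalemxAl mulmxK // unitmx_mul u' -ME; apply: unit_det1.
    exact: ker_mx_det.
  rewrite map_mx2 => /matrixP E; exists l; split=> //.
    by have := E 0 0; rewrite !mxE.
  by have := E 0 1; rewrite !mxE.
have [e e0 eE] : exists2 e, e != 0 & e \in [:: x1; y1; z].
  have [x10|x10] := eqVneq x1 0; last by exists x1; rewrite // inE eqxx.
  have [y10|y10] := eqVneq y1 0; last by exists y1; rewrite // !inE eqxx orbT.
  exists z; last by rewrite !inE eqxx !orbT.
  apply: contraNneq nz0 => ->; by have [-> ->] := row_mul_eq0 h1 x10 y10.
have fix_e (w : S) : w \in [:: x1; y1; z] -> exists w0, iota w0 = e^-1 * w.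
  move=> wE; apply: gal_fixed_field => s; have [l [lx ly lz]] := sxyz s.
  have sl v : v \in [:: x1; y1; z] -> s v = l * v by rewrite !inE => /or3P[]/eqP ->.
  have l0 : l != 0 by apply: contraNneq e0 => l0; rewrite -(fmorph_eq0 s) sl // l0 mul0r.
  by rewrite rmorphM fmorphV !sl //; field; rewrite l0 e0.
have [|x0 x0E] := fix_e x1; rewrite ?inE ?eqxx //.
have [|y0 y0E] := fix_e y1; rewrite ?inE ?eqxx ?orbT //.
have [|z0 z0E] := fix_e z; rewrite ?inE ?eqxx ?orbT //.
exists x0, y0, z0; split.
  have : (x1, y1, z) != (0, 0, 0).
    apply: contraNneq e0 => -[x10 y10 z10]; move: eE.
    by rewrite x10 y10 z10 !inE !orbb.
  apply: contraNneq => -[x00 y00 z00]; move: x0E y0E z0E.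
  rewrite x00 y00 z00 rmorph0.
  have div0 (w : S) : 0 = e^-1 * w -> w = 0.
    by move/esym/eqP; rewrite mulf_eq0 invr_eq0 (negPf e0) => /eqP.
  by move=> /div0 -> /div0 -> /div0 ->.
apply: (fmorph_inj iota); rewrite cfeval_map rmorphXn z0E x0E y0E cfevalZ -fz.
by rewrite exprMn.
Qed.

End Twist.

Lemma twist_form0 (K : fieldType) (S : sep_closure K) (k : K) :
  twist (S := S) k (form0 k) (fun=> Infty).
Proof.
split=> [s|]; first by split.
exists 1%:M; split=> [||s]; first exact: det1.
- by rewrite cfact1 form0_map.
- by rewrite mul1mx map_mx1.
Qed.

Lemma sl2_stab_iso (K : fieldType) (S : sep_closure K) (k : K) f :
  (2 : K) != 0 -> (3 : K) != 0 -> k != 0 -> cfdisc f = 4 * k ->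
  group_iso (sl2_stab f) mulmx (ker_phihat k) (@padd K).
Proof.
move=> n2 n3 k0 df; set kS := sc_inj S k.
have m2 : (2 : S) != 0 by rewrite -(rmorph_nat (sc_inj S)) fmorph_eq0.
have m3 : (3 : S) != 0 by rewrite -(rmorph_nat (sc_inj S)) fmorph_eq0.
have kS0 : kS != 0 by rewrite fmorph_eq0.
have [c [Ac [g [g1 gf gc]]]] := twist_exists S n2 n3 k0 df.
have ug : g \in unitmx by rewrite unitmxE g1 unitr1.
pose conj h P := map_mx (sc_inj S) h *m g = g *m map_mx (sc_inj S) (ker_mx k P).
have stab_conj h : sl2_stab f h -> exists2 P, ker_phihat k P & conj h P.
  move=> [h1 hf].
  have [||P AP PE] :=
    @stab_form0 _ kS m2 m3 kS0 (invmx g *m (map_mx (sc_inj S) h *m g)).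
  - by rewrite !det_mulmx det_inv det_map_mx (h1 : \det h = 1) rmorph1 g1 invr1 !mul1r.
  - by rewrite !cfactM gf -cform_map_act hf -gf -cfactM mulVmx // cfact1.
  have {}PE : map_mx (sc_inj S) h *m g = g *m ker_mx kS P by rewrite -PE mulKVmx.
  have fixP (s : gal S) : point_map s P = P.
    apply: (@ker_mx_inj _ kS m2 m3) => //; first exact: ker_gal.
    have := congr1 (map_mx s) PE; rewrite !map_mxM gc -ker_mx_gal.
    have -> : map_mx s (map_mx (sc_inj S) h) = map_mx (sc_inj S) h.
      by apply/matrixP => i j; rewrite !mxE gal_fix.
    rewrite mulmxA PE -!mulmxA (ker_mxC m2 m3 kS0 AP (Ac s)).
    move/(congr1 (mulmx (invmx g))); rewrite !mulKmx // => E.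
    have uc : ker_mx kS (c s) \in unitmx by rewrite unitmxE ker_mx_det // unitr1.
    by have := congr1 (mulmx (invmx (ker_mx kS (c s)))) E; rewrite !mulKmx.
  have [P0 P0E] : exists P0, point_map (sc_inj S) P0 = P.
    case: P fixP {AP PE} => [|X Y] XY; first by exists Infty.
    have [|X' XE] := @gal_fixed_field _ S X; first by move=> s; have [] := XY s.
    have [|Y' YE] := @gal_fixed_field _ S Y; first by move=> s; have [] := XY s.
    by exists (Aff X' Y'); rewrite /= XE YE.
  exists P0; first by apply/(ker_phihat_map (sc_inj S)); rewrite P0E.
  by rewrite /conj PE -P0E ker_mx_map.
have conj_stab P : ker_phihat k P -> exists2 h, sl2_stab f h & conj h P.
  move=> AP; have AP' : ker_phihat kS (point_map (sc_inj S) P) by apply/ker_phihat_map.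
  have [|h hE] := @gal_fixed_mx _ S (g *m map_mx (sc_inj S) (ker_mx k P) *m invmx g).
    move=> s; rewrite !map_mxM map_invmx gc.
    have -> : map_mx s (map_mx (sc_inj S) (ker_mx k P)) = map_mx (sc_inj S) (ker_mx k P).
      by apply/matrixP => i j; rewrite !mxE gal_fix.
    have uc : ker_mx kS (c s) \in unitmx by rewrite unitmxE ker_mx_det // unitr1.
    have ugc : g *m ker_mx kS (c s) \in unitmx by rewrite unitmx_mul ug.
    rewrite -ker_mx_map -/kS -[_ *m _ *m ker_mx kS (point_map _ _)]mulmxA.
    rewrite (ker_mxC m2 m3 kS0 (Ac s) AP') mulmxA.
    by apply: (can_inj (mulmxK ugc)); rewrite mulmxKV // mulmxA mulmxKV.
  have {}hE : conj h P by rewrite /conj hE mulmxKV.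
  exists h => //; split.
    apply: (fmorph_inj (sc_inj S)); have := congr1 determinant hE.
    by rewrite !det_mulmx -ker_mx_map ker_mx_det // g1 !mulr1 det_map_mx rmorph1.
  apply: (@cform_map_inj _ _ (sc_inj S)); rewrite cform_map_act -gf -cfactM hE cfactM.
  by rewrite -ker_mx_map ker_mx_act.
have conj_injr h P P' : ker_phihat k P -> ker_phihat k P' -> conj h P -> conj h P' -> P = P'.
  move=> AP AP' E E'; apply: (@ker_mx_inj _ k n2 n3) => //.
  apply: (@map_mx2_inj _ _ (sc_inj S)).
  by move: E'; rewrite /conj E => /(congr1 (mulmx (invmx g))); rewrite !mulKmx.
have conj_injl h h' P : conj h P -> conj h' P -> h = h'.
  move=> E E'; apply: (@map_mx2_inj _ _ (sc_inj S)).
  by move: E'; rewrite /conj -E => /(congr1 (mulmx^~ (invmx g))); rewrite !mulmxK.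
pose H h := if pselect (sl2_stab f h) is left hf then s2val (cid2 (stab_conj h hf)) else Infty.
have HP h : sl2_stab f h -> ker_phihat k (H h) /\ conj h (H h).
  by rewrite /H; case: pselect => // hf _; case: cid2.
exists H; split; first split.
- by move=> h /HP[].
- move=> h h' /set_mem/HP[_ E] /set_mem/HP[_ E'] HE.
  by apply: conj_injl E _; rewrite HE.
- move=> P AP; have [h hf E] := conj_stab P AP; exists h => //.
  by have [AH EH] := HP h hf; apply: conj_injr EH E.
move=> h h' hf hf'; have [AP E] := HP h hf; have [AP' E'] := HP h' hf'.
have [APP M] := ker_mx_mul n2 n3 k0 AP AP'.
have hhf : sl2_stab f (h *m h').
  case: hf hf' => [h1 hf] [h1' hf']; split; last by rewrite cfactM hf' hf.
  by rewrite /sl2 /= det_mulmx (h1 : \det h = 1) (h1' : \det h' = 1) mulr1.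
have [AH EH] := HP _ hhf; apply: conj_injr AH APP EH _.
by rewrite /conj M !map_mxM -mulmxA E' mulmxA E mulmxA.
Qed.

Section Restriction.
Variables (R : realType) (F : fieldType) (S : sep_closure F) (v : place R F).
Variables (L : localization S v) (k : F).

Lemma twist_res f c : twist (S := S) k f c ->
  twist (S := loc_sep L) (cp_inj L k) (cform_map (cp_inj L) f) (cochain_res (L := L) c).
Proof.
move=> [Ac [g [g1 gf gc]]].
split=> [s|]; first by rewrite -loc_embE; apply/ker_phihat_map.
exists (map_mx (loc_emb L) g); split=> [||s].
- by rewrite det_map_mx g1 rmorph1.
- have -> : form0 (sc_inj (loc_sep L) (cp_inj L k)) = cform_map (loc_emb L) (form0 (sc_inj S k)).
    by rewrite /form0 cform_mapE rmorph0 rmorph1 loc_embE.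
  rewrite -cform_map_act gf; case: (f) => a b c' d.
  by rewrite !cform_mapE !loc_embE.
- rewrite -loc_embE ker_mx_map -map_mxM -gc.
  by apply/matrixP => i j; rewrite !mxE /= gal_res_funE.
Qed.

Hypotheses (n2 : (2 : F) != 0) (n3 : (3 : F) != 0) (k0 : k != 0).

Let l2 : (2 : L) != 0. Proof. by rewrite -(rmorph_nat (cp_inj L)) fmorph_eq0. Qed.
Let l3 : (3 : L) != 0. Proof. by rewrite -(rmorph_nat (cp_inj L)) fmorph_eq0. Qed.
Let l0 : cp_inj L k != 0. Proof. by rewrite fmorph_eq0. Qed.

Lemma h1_res_twist f c : twist (S := S) k f c ->
  h1_res k (L := L) (h1_class (ker_phihat (sc_inj S k)) c) =
  h1_class (ker_phihat (sc_inj (loc_sep L) (cp_inj L k))) (cochain_res (L := L) c).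
Proof.
move=> fc; rewrite (twist_class n2 n3 k0 fc) (twist_class l2 l3 l0 (twist_res fc)).
apply/seteqP; split=> [c1 [c2 /= fc2]|c1 fc1].
  by rewrite (twist_class l2 l3 l0 (twist_res fc2)).
by exists c => //; rewrite (twist_class l2 l3 l0 (twist_res fc)).
Qed.

Lemma soluble_connecting f c : twist (S := S) k f c ->
  (exists x y z : L, (x, y, z) != (0, 0, 0) /\
     z ^+ 3 = cfeval (cform_map (cp_inj L) f) x y) <->
  connecting_image (loc_sep L) (cp_inj L k)
    (h1_res k (L := L) (h1_class (ker_phihat (sc_inj S k)) c)).
Proof.
move=> fc; rewrite (h1_res_twist fc); split.
  by move=> [x [y [z [nz zE]]]]; apply: twist_connecting (twist_res fc) nz zE.
exact: connecting_twist (twist_res fc).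
Qed.

End Restriction.

Theorem theorem23 (R : realType) (F : fieldType) (k : F)
    (hF : global_field F)
    (h2 : 2%N \notin [pchar F]) (h3 : 3%N \notin [pchar F])
    (hk : k != 0)
    (Fsep : sep_closure F)
    (loc : forall v : place R F, localization Fsep v) :
  let f0 : cform F := CForm k 0 1 0 in
  [/\ exists Phi : set (cform F) -> set (cochain Fsep),
        [/\ set_bij (soluble_orbits loc k) (selmer loc k) Phi,
            soluble_orbits loc k (sl2_orbit f0) &
            Phi (sl2_orbit f0) = h1_zero (ker_phihat (sc_inj Fsep k))],
      [set f : cform F | cform_reducible f /\ cfdisc f = 4 * k] = sl2_orbit f0 &
      forall f : cform F, locally_soluble loc f -> cfdisc f = 4 * k ->
        group_iso (sl2_stab f) mulmx (ker_phihat k) (@padd F)].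
Proof.
have n2 : (2 : F) != 0 by move: h2; rewrite inE.
have n3 : (3 : F) != 0 by move: h3; rewrite inE.
move=> f0; pose tw f := [set c | twist (S := Fsep) k f c].
have f0_soluble : locally_soluble loc f0.
  move=> v; exists 0, 1, 0; rewrite !xpair_eqE oner_eq0 andbF; split=> //.
  by rewrite /cfeval /= rmorph0; ring.
have f0_disc : cfdisc f0 = 4 * k by apply: cfdisc_form0.
have soluble_selmer f c : twist (S := Fsep) k f c ->
    locally_soluble loc f <-> selmer loc k (h1_class (ker_phihat (sc_inj Fsep k)) c).
  move=> fc; split=> [sol|[_ sel] v].
    split=> [|v]; first by exists c => //; apply: twist_cocycle fc.
    apply/(soluble_connecting (loc v) n2 n3 hk fc).
    by have [x [y [z [nz zE]]]] := sol v; exists x, y, z.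
  have /(soluble_connecting (loc v) n2 n3 hk fc)[x [y [z [nz zE]]]] := sel v.
  by exists x, y, z.
split.
- exists (fun O => [set c | exists2 f, O f & twist (S := Fsep) k f c]).
  have tw_orbit f : [set c | exists2 f', sl2_orbit f f' & twist (S := Fsep) k f' c] = tw f.
    apply/seteqP; split=> c /=; last first.
      by move=> fc; exists f => //; exists 1%:M; [apply: det1|apply: cfact1].
    move=> [_ [h h1 <-] fc].
    have uh : h \in unitmx by rewrite unitmxE (h1 : \det h = 1) unitr1.
    rewrite /tw /= -[f]cfact1 -(mulVmx uh) cfactM; apply: twist_orbit => //.
    by rewrite det_inv (h1 : \det h = 1) invr1.
  split; [split| |].
  + move=> _ [f [sol df] <-]; rewrite tw_orbit.
    have [c fc] := twist_exists Fsep n2 n3 hk df.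
    by rewrite /tw -(twist_class n2 n3 hk fc); apply/(soluble_selmer _ _ fc).
  + move=> _ _ /set_mem[f [sol df] <-] /set_mem[f' [sol' df'] <-].
    rewrite !tw_orbit => E; have [c fc] := twist_exists Fsep n2 n3 hk df.
    have fc' : tw f' c by rewrite -E.
    have [h h1 <-] := twist_inj n2 n3 hk fc fc'.
    have uh : h \in unitmx by rewrite unitmxE h1 unitr1.
    apply/seteqP; split=> _ [l l1 <-].
      exists (l *m invmx h); last by rewrite -cfactM mulmxKV.
      by rewrite /sl2 /= det_mulmx det_inv h1 invr1 mulr1.
    by exists (l *m h); rewrite ?cfactM // /sl2 /= det_mulmx h1 mulr1.
  + move=> _ [[c cc <-] sel]; have [f df fc] := twist_surj n2 n3 hk cc.
    exists (sl2_orbit f); last by rewrite tw_orbit /tw -(twist_class n2 n3 hk fc).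
    exists f => //; split=> //; apply/(soluble_selmer _ _ fc).
    by split=> //; exists c.
  + by exists f0.
  + by rewrite tw_orbit /tw -(twist_class n2 n3 hk (twist_form0 Fsep k)).
- apply/seteqP; split=> [f [fr df]|_ [g g1 <-]].
    by have [g g1 gE] := reducible_form0_orbit n2 n3 hk df fr; exists g.
  by split; [apply: form0_orbit_reducible|rewrite cfdisc_act].
- by move=> f _ df; apply: (sl2_stab_iso Fsep).
Qed.
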